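(* Let $R$ be a Cohen-Macaulay (commutative Noetherian) local ring of dimension $1$ and let $M$ be a finitely generated torsion-free $R$-module of positive rank satisfying $\operatorname{Ext}^1_R(M,M)=0$. Suppose additionally that at least one of the following holds: (1) $M$ is reflexive as a $Z(\operatorname{End}_R(M))$-module. (2) $\operatorname{Ext}^2_{Z(\operatorname{End}_R(M))}(M,M)=0$. (3) $M\cong I$, where $I$ is an ideal of positive grade in $R$ and $\operatorname{Ext}^1_{\operatorname{End}_R(I)}(I,\operatorname{End}_R(I))=0$. Then $Z(\operatorname{End}_R(M))\cong R$ as $R$-algebras. If, additionally, $M$ is a reflexive $R$-module, then $R$ is a direct summand of $M$.
   Context: $\operatorname{End}_R(M)$ is the ring of $R$-linear endomorphisms of $M$ and $Z(\operatorname{End}_R(M))$ is its center, a commutative $R$-algebra. $M$ is a left $\operatorname{End}_R(M)$-module via $f\cdot x=f(x)$, hence also a $Z(\operatorname{End}_R(M))$-module. For a commutative ring $S$, an $S$-module $N$ is reflexive if the natural map $N\to\operatorname{Hom}_S(\operatorname{Hom}_S(N,S),S)$ is an isomorphism. $M$ has rank $r$ if $M\otimes_R Q$ is a free $Q$-module of rank $r$, where $Q$ is the total quotient ring of $R$; positive rank means it has a rank $r>0$. $M$ is torsion-free if no nonzero element of $M$ is annihilated by a nonzerodivisor of $R$. An ideal has positive grade if it contains a nonzerodivisor of $R$; for such an ideal $I$, the ring $\operatorname{End}_R(I)$ is commutative. *)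

(* Defs.v *)
From HB Require Import structures.
From mathcomp Require Import all_boot all_algebra.
From mathcomp Require Import ring_quotient sesquilinear.
From mathcomp Require Import boolp functions prodnormedzmodule.

Set Implicit Arguments.
Unset Strict Implicit.
Unset Printing Implicit Defensive.

Import GRing.Theory.
Local Open Scope ring_scope.

Section HomZmodule.
Variables (S : pzRingType) (A B : lmodType S).
Implicit Types f g h : {linear A -> B}.

Lemma linear_eqP f g : f =1 g -> f = g.
Proof.
case: f g => [f cf] [g cg] fg.
have {fg} /= fg : f = g by apply/funext => x; exact: fg x.
case: _ / fg in cg *.
case: cf cg => [[a1] [a2]] [[b1] [b2]].
by rewrite (Prop_irrelevance a1 b1) (Prop_irrelevance a2 b2).
Qed.

Definition hom_zero : {linear A -> B} := (\0 : A -> B).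
Definition hom_opp f : {linear A -> B} := (\- f).
Definition hom_add f g : {linear A -> B} := (f \+ g).

Lemma hom_addA : associative hom_add.
Proof. by move=> f g h; apply: linear_eqP => x; apply: addrA. Qed.
Lemma hom_addC : commutative hom_add.
Proof. by move=> f g; apply: linear_eqP => x; apply: addrC. Qed.
Lemma hom_add0 : left_id hom_zero hom_add.
Proof. by move=> f; apply: linear_eqP => x; apply: add0r. Qed.
Lemma hom_addN : left_inverse hom_zero hom_opp hom_add.
Proof. by move=> f; apply: linear_eqP => x; apply: addNr. Qed.

HB.instance Definition _ := GRing.isZmodule.Build {linear A -> B}
  hom_addA hom_addC hom_add0 hom_addN.
End HomZmodule.

Section HomLmodule.
Variables (S : comPzRingType) (A B : lmodType S).
Implicit Types f g : {linear A -> B}.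

Definition hom_scale (a : S) f : {linear A -> B} := (a \*: f).

Lemma hom_scaleA a b f : hom_scale a (hom_scale b f) = hom_scale (a * b) f.
Proof. by apply: linear_eqP => x; apply: scalerA. Qed.
Lemma hom_scale1 : left_id 1 hom_scale.
Proof. by move=> f; apply: linear_eqP => x; apply: scale1r. Qed.
Lemma hom_scaleDr : right_distributive hom_scale +%R.
Proof. by move=> a f g; apply: linear_eqP => x; apply: scalerDr. Qed.
Lemma hom_scaleDl f : {morph hom_scale^~ f : a b / a + b}.
Proof. by move=> a b; apply: linear_eqP => x; apply: scalerDl. Qed.

HB.instance Definition _ := GRing.Zmodule_isLmodule.Build S {linear A -> B}
  hom_scaleA hom_scale1 hom_scaleDr hom_scaleDl.
End HomLmodule.

Definition End (S : pzRingType) (M : lmodType S) : Type := {linear M -> M}.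

Section EndRing.
Variables (S : pzRingType) (M : lmodType S).

HB.instance Definition _ := GRing.Zmodule.copy (End M) {linear M -> M}.

Definition end_one : End M := idfun.
Definition end_mul (f g : End M) : End M := (f \o g).

Lemma end_mulA : associative end_mul.
Proof. by move=> f g h; apply: linear_eqP. Qed.
Lemma end_mul1r : left_id end_one end_mul.
Proof. by move=> f; apply: linear_eqP. Qed.
Lemma end_mulr1 : right_id end_one end_mul.
Proof. by move=> f; apply: linear_eqP. Qed.
Lemma end_mulDl : left_distributive end_mul +%R.
Proof. by move=> f g h; apply: linear_eqP. Qed.
Lemma end_mulDr : right_distributive end_mul +%R.
Proof. by move=> f g h; apply: linear_eqP => x; apply: linearD. Qed.

HB.instance Definition _ := GRing.Zmodule_isPzRing.Build (End M)
  end_mulA end_mul1r end_mulr1 end_mulDl end_mulDr.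
End EndRing.

HB.instance Definition _ (S : comPzRingType) (M : lmodType S) :=
  GRing.Lmodule.copy (End M) {linear M -> M}.

Definition ring_center (A : pzRingType) : {pred A} :=
  fun a => `[< forall b, b * a = a * b >].
Arguments ring_center : clear implicits.

Section CenterRing.
Variable A : pzRingType.

Lemma centerP (a : A) : reflect (forall b, b * a = a * b) (a \in ring_center A).
Proof. exact: asboolP. Qed.

Lemma center_subring : subring_closed (ring_center A).
Proof.
split=> [|a b /centerP ca /centerP cb|a b /centerP ca /centerP cb].
- by apply/centerP => c; rewrite mulr1 mul1r.
- by apply/centerP => c; rewrite mulrBr mulrBl ca cb.
- by apply/centerP => c; rewrite mulrA ca -mulrA cb mulrA.
Qed.

HB.instance Definition _ := GRing.isSubringClosed.Build A (ring_center A) center_subring.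
End CenterRing.

(* The ring Z(End_S(M)); over a commutative S it is also an S-module below. *)
Definition Zend (S : pzRingType) (M : lmodType S) : Type :=
  {f : End M | f \in ring_center (End M)}.

Section CenterEnd.
Variables (S : pzRingType) (M : lmodType S).

HB.instance Definition _ := SubChoice.copy (Zend M) {f : End M | f \in ring_center (End M)}.
HB.instance Definition _ := GRing.SubChoice_isSubPzRing.Build _ _ (Zend M) (subringClosedP _).

Lemma Zend_mulC : commutative (@GRing.mul (Zend M)).
Proof.
move=> f g; apply: val_inj; rewrite !rmorphM /=.
by have /centerP -> := valP g.
Qed.
HB.instance Definition _ := GRing.PzRing_hasCommutativeMul.Build (Zend M) Zend_mulC.
End CenterEnd.

Section CenterEndLmodule.
Variables (S : comPzRingType) (M : lmodType S).

Lemma center_scale : GRing.scaler_closed (ring_center (End M)).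
Proof.
move=> a f /centerP cf; apply/centerP => g; apply: linear_eqP => x.
have e := congr1 (fun h : End M => h x) (cf g).
by change (g (a *: f x) = a *: f (g x)); rewrite linearZ; congr (_ *: _).
Qed.

HB.instance Definition _ :=
  GRing.isScaleClosed.Build S (End M) (ring_center (End M)) center_scale.
HB.instance Definition _ := [SubZmodule_isSubLmodule of Zend M by <:].
End CenterEndLmodule.

(* M as a left End_S(M)-module; an alias, since M itself carries its S-module
   structure. *)
Definition end_module (S : pzRingType) (M : lmodType S) : Type := M.

Section EndModule.
Variables (S : pzRingType) (M : lmodType S).

HB.instance Definition _ := GRing.Zmodule.copy (end_module M) M.

Definition end_act (f : End M) (x : end_module M) : end_module M := f x.

Lemma end_actA f g x : end_act f (end_act g x) = end_act (f * g) x.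
Proof. by []. Qed.
Lemma end_act1 : left_id 1 end_act.
Proof. by []. Qed.
Lemma end_actDr : right_distributive end_act +%R.
Proof. by move=> f x y; apply: linearD. Qed.
Lemma end_actDl x : {morph end_act^~ x : f g / f + g}.
Proof. by []. Qed.

HB.instance Definition _ := GRing.Zmodule_isLmodule.Build (End M) (end_module M)
  end_actA end_act1 end_actDr end_actDl.
End EndModule.

(* N as an S-module through iota. *)
Definition restrict (S T : pzRingType) (iota : {rmorphism S -> T})
  (N : lmodType T) : Type := N.

Section RestrictScalars.
Variables (S T : pzRingType) (iota : {rmorphism S -> T}) (N : lmodType T).

HB.instance Definition _ := GRing.Zmodule.copy (restrict iota N) N.

Definition restrict_scale (a : S) (x : restrict iota N) : restrict iota N :=
  iota a *: (x : N).

Lemma restrict_scaleA a b x :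
  restrict_scale a (restrict_scale b x) = restrict_scale (a * b) x.
Proof. by rewrite /restrict_scale rmorphM scalerA. Qed.
Lemma restrict_scale1 : left_id 1 restrict_scale.
Proof. by move=> x; rewrite /restrict_scale rmorph1 scale1r. Qed.
Lemma restrict_scaleDr : right_distributive restrict_scale +%R.
Proof. by move=> a x y; apply: scalerDr. Qed.
Lemma restrict_scaleDl x : {morph restrict_scale^~ x : a b / a + b}.
Proof. by move=> a b; rewrite /restrict_scale rmorphD scalerDl. Qed.

HB.instance Definition _ := GRing.Zmodule_isLmodule.Build S (restrict iota N)
  restrict_scaleA restrict_scale1 restrict_scaleDr restrict_scaleDl.
End RestrictScalars.

Definition zend_module (S : pzRingType) (M : lmodType S) : lmodType (Zend M) :=
  restrict (val : {rmorphism Zend M -> End M}) (end_module M).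

(* Possibly the unit ideal, unlike idealr and prime_idealr of ring_quotient. *)
Definition ideal (R : pzRingType) := submodClosed R^o.

Definition ideal_module (R : pzRingType) (I : ideal R) : Type := {x : R^o | x \in I}.
Section IdealModule.
Variables (R : pzRingType) (I : ideal R).
HB.instance Definition _ := SubChoice.copy (ideal_module I) {x : R^o | x \in I}.
HB.instance Definition _ := [SubChoice_isSubLmodule of ideal_module I by <:].
End IdealModule.

Definition isomorphic (S : pzRingType) (A B : lmodType S) :=
  exists f : {linear A -> B}, bijective f.

Definition finitely_generated (S : pzRingType) (A : lmodType S) :=
  exists n (e : 'I_n -> A), forall x, exists c : 'I_n -> S, x = \sum_i c i *: e i.

(* GRing.lreg s : multiplication by s is injective, i.e. s is a nonzerodivisor. *)
Definition torsion_free (S : pzRingType) (A : lmodType S) :=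
  forall (s : S) (x : A), GRing.lreg s -> s *: x = 0 -> x = 0.

Definition biduality (S : comPzRingType) (A : lmodType S) (x : A)
  (phi : {linear A -> S^o}) : S^o := phi x.

Section Biduality.
Variables (S : comPzRingType) (A : lmodType S).

Lemma biduality_linear (x : A) : linear (biduality x).
Proof. by []. Qed.
HB.instance Definition _ (x : A) :=
  GRing.isLinear.Build S {linear A -> S^o} S^o _ (biduality x) (biduality_linear x).
End Biduality.

Definition reflexive_module (S : comPzRingType) (A : lmodType S) :=
  bijective (fun x : A => biduality x : {linear {linear A -> S^o} -> S^o}).

Definition direct_summand (S : pzRingType) (B A : lmodType S) :=
  exists C : lmodType S, isomorphic A (B * C)%type.

Definition surjective (X Y : Type) (f : X -> Y) := forall y, exists x, f x = y.

Definition projective (S : pzRingType) (P : lmodType S) :=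
  forall (A B : lmodType S) (p : {linear A -> B}) (f : {linear P -> B}),
    surjective p -> exists g : {linear P -> A}, forall x, p (g x) = f x.

Record projective_resolution (S : pzRingType) (M : lmodType S) :=
  ProjectiveResolution {
    res_term : nat -> lmodType S;
    res_diff : forall n, {linear res_term n.+1 -> res_term n};
    res_augm : {linear res_term 0 -> M};
    res_projective : forall n, projective (res_term n);
    res_augm_surj : surjective res_augm;
    res_exact0 : forall x, res_augm x = 0 <-> exists y, res_diff 0 y = x;
    res_exactS : forall n x,
      res_diff n x = 0 <-> exists y, res_diff n.+1 y = x }.

Section Ext.
Variables (S : pzRingType) (M N : lmodType S) (P : projective_resolution M).

Definition cocycle n (f : {linear res_term P n -> N}) :=
  forall x, f (res_diff P n x) = 0.

Definition coboundary n : {linear res_term P n -> N} -> Prop :=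
  if n is k.+1 then fun f =>
    exists g : {linear res_term P k -> N}, forall x, f x = g (res_diff P k x)
  else fun f => forall x, f x = 0.
End Ext.

(* H^n(Hom(P, N)) = 0. This does not depend on the choice of the projective
   resolution P, and one always exists by projective_resolution_exists. *)
Definition Ext_vanishes (S : pzRingType) (n : nat) (M N : lmodType S) :=
  forall (P : projective_resolution M) (f : {linear res_term P n -> N}),
    cocycle f -> coboundary f.

Section FreeModule.
Variables (S : pzRingType) (X : choiceType).

Definition finite_support : {pred X -> S^o} :=
  fun v => `[< exists s : seq X, forall x, x \notin s -> v x = 0 >].

Lemma finite_supportP (v : X -> S^o) :
  reflect (exists s : seq X, forall x, x \notin s -> v x = 0) (v \in finite_support).
Proof. exact: asboolP. Qed.

Lemma finite_support_submod : submod_closed finite_support.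
Proof.
split=> [|a u v /finite_supportP [s su] /finite_supportP [t tv]].
  by apply/finite_supportP; exists [::].
apply/finite_supportP; exists (s ++ t) => x; rewrite mem_cat negb_or.
by case/andP=> /su ux /tv vx; rewrite !fctE /= ux vx scaler0 addr0.
Qed.
HB.instance Definition _ :=
  GRing.isSubmodClosed.Build S (X -> S^o) finite_support finite_support_submod.

Definition free_module : Type := {v : X -> S^o | v \in finite_support}.
HB.instance Definition _ :=
  SubChoice.copy free_module {v : X -> S^o | v \in finite_support}.
HB.instance Definition _ := [SubChoice_isSubLmodule of free_module by <:].

Implicit Types (u v : free_module) (x : X).

Definition coef v x : S := val v x.

Definition covers (s : seq X) v := uniq s /\ forall x, x \notin s -> coef v x = 0.

Lemma cover_exists v : exists s, covers s v.
Proof.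
have /finite_supportP [s sv] := valP v; exists (undup s); split=> [|x].
  exact: undup_uniq.
by rewrite mem_undup; apply: sv.
Qed.
Definition free_support v := projT1 (cid (cover_exists v)).
Lemma supportP v : covers (free_support v) v.
Proof. exact: projT2 (cid (cover_exists v)). Qed.

Section Lift.
Variables (A : lmodType S) (g : X -> A).

Definition free_lift v : A := \sum_(x <- free_support v) coef v x *: g x.

Lemma free_liftE s v : covers s v -> free_lift v = \sum_(x <- s) coef v x *: g x.
Proof.
have aux t : covers t v ->
    \sum_(x <- t) coef v x *: g x = \sum_(x <- [seq x <- t | coef v x != 0]) coef v x *: g x.
  move=> _; rewrite big_filter [RHS]big_mkcond; apply: eq_bigr => x _.
  by case: eqP => //= ->; rewrite scale0r.
move=> cs; rewrite /free_lift (aux _ (supportP v)) (aux _ cs).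
apply: perm_big; apply: uniq_perm.
- by apply: filter_uniq; case: (supportP v).
- by apply: filter_uniq; case: cs.
move=> x; rewrite !mem_filter; case: eqP => //= vx.
have [_ h1] := supportP v; have [_ h2] := cs.
apply/idP/idP => _.
  by case: (boolP (x \in s)) => // /h2.
by case: (boolP (x \in free_support v)) => // /h1.
Qed.

Lemma free_lift_linear : linear free_lift.
Proof.
move=> a u v; pose s := undup (free_support u ++ free_support v).
have [[_ hu] [_ hv]] := (supportP u, supportP v).
have cu : covers s u.
  split=> [|x]; first exact: undup_uniq.
  by rewrite mem_undup mem_cat negb_or => /andP [/hu].
have cv : covers s v.
  split=> [|x]; first exact: undup_uniq.
  by rewrite mem_undup mem_cat negb_or => /andP [_ /hv].
have cuv : covers s (a *: u + v).
  case: cu => s_uniq hu'; case: cv => _ hv'; split=> // x xs.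
  by change (a * coef u x + coef v x = 0); rewrite hu' // hv' // mulr0 addr0.
rewrite (free_liftE cuv) (free_liftE cu) (free_liftE cv) scaler_sumr -big_split /=.
by apply: eq_bigr => x _; rewrite scalerA -scalerDl.
Qed.
HB.instance Definition _ := GRing.isLinear.Build S free_module A _ free_lift free_lift_linear.
End Lift.

Lemma dirac_subproof x : (fun y => (y == x)%:R : S^o) \in finite_support.
Proof.
by apply/finite_supportP; exists [:: x] => y; rewrite inE => /negPf ->.
Qed.
Definition dirac x : free_module :=
  exist (fun w => w \in finite_support) _ (dirac_subproof x).

Lemma coef_dirac x y : coef (dirac x) y = (y == x)%:R.
Proof. by []. Qed.

Lemma dirac_covers x : covers [:: x] (dirac x).
Proof. by split=> // y; rewrite inE coef_dirac => /negPf ->. Qed.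

Lemma free_lift_dirac (A : lmodType S) (g : X -> A) x : free_lift g (dirac x) = g x.
Proof. by rewrite (free_liftE _ (dirac_covers x)) big_seq1 coef_dirac eqxx scale1r. Qed.

Lemma free_decomp v : v = \sum_(x <- free_support v) coef v x *: dirac x.
Proof.
have coef_sum (s : seq X) y :
    coef (\sum_(x <- s) coef v x *: dirac x) y = \sum_(x <- s) coef v x * (y == x)%:R.
  elim: s => [|x s IHs]; rewrite ?big_nil // !big_cons -IHs.
  by [].
have [s_uniq hv] := supportP v.
apply: val_inj; apply/funext => y; change (coef v y = coef (\sum_(x <- free_support v) coef v x *: dirac x) y).
rewrite coef_sum; have [ys|ys] := boolP (y \in free_support v); last first.
  rewrite hv // big_seq big1 // => x xs.
  by case: eqP => [e|]; rewrite ?mulr0 // -e (negPf ys) in xs *.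
rewrite (bigD1_seq y) //= big1 ?addr0 ?eqxx ?mulr1 //.
by move=> x /negPf; rewrite eq_sym => ->; rewrite mulr0.
Qed.

Lemma free_projective : projective free_module.
Proof.
move=> A B p f psurj.
have h x : exists a, p a = f (dirac x) by apply: psurj.
exists (free_lift (fun x => projT1 (cid (h x)))) => v /=.
rewrite [in RHS](free_decomp v) /free_lift !linear_sum; apply: eq_bigr => x _.
by rewrite !linearZ; congr (_ *: _); exact: projT2 (cid (h x)).
Qed.
End FreeModule.

Section ResolutionExists.
Variable S : pzRingType.

Definition free_cover (A : lmodType S) : {linear free_module S A -> A} :=
  free_lift (fun x : A => x).

Lemma free_cover_surj (A : lmodType S) : surjective (free_cover A).
Proof. by move=> x; exists (dirac S x); apply: free_lift_dirac. Qed.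

Definition kernel_pred (A : lmodType S) : {pred free_module S A} :=
  fun v => free_cover A v == 0.
Arguments kernel_pred : clear implicits.

Lemma kernel_submod (A : lmodType S) : submod_closed (kernel_pred A).
Proof.
split=> [|a u v]; rewrite !unfold_in ?linear0 // => /eqP u0 /eqP v0.
by rewrite linearP u0 v0 scaler0 addr0.
Qed.
HB.instance Definition _ (A : lmodType S) := GRing.isSubmodClosed.Build S
  (free_module S A) (kernel_pred A) (kernel_submod A).

Definition syzygy (A : lmodType S) : Type := {v | v \in kernel_pred A}.
HB.instance Definition _ (A : lmodType S) :=
  SubChoice.copy (syzygy A) {v | v \in kernel_pred A}.
HB.instance Definition _ (A : lmodType S) := [SubChoice_isSubLmodule of syzygy A by <:].

Fixpoint syzygies (M : lmodType S) n : lmodType S :=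
  if n is k.+1 then syzygy (syzygies M k) else M.

Definition free_diff (A : lmodType S) :
    {linear free_module S (syzygy A) -> free_module S A} :=
  (val : {linear syzygy A -> free_module S A}) \o free_cover (syzygy A).

Lemma free_diff_exact (A : lmodType S) x :
  free_cover A x = 0 <-> exists y, free_diff A y = x.
Proof.
split=> [/eqP x0|[y <-]]; last by apply/eqP; apply: (valP (free_cover (syzygy A) y)).
by have [y yx] := free_cover_surj (exist (fun w => w \in kernel_pred A) x x0 : syzygy A); exists y; rewrite /= yx.
Qed.

Lemma projective_resolution_exists (M : lmodType S) :
  inhabited (projective_resolution M).
Proof.
constructor; apply: (@ProjectiveResolution S M (fun n => free_module S (syzygies M n))
  (fun n => free_diff (syzygies M n)) (free_cover M)).
- by move=> n; apply: free_projective.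
- exact: free_cover_surj.
- exact: free_diff_exact.
move=> n x; rewrite -(@free_diff_exact (syzygies M n.+1) x) /=.
split=> [e|->]; last by [].

by apply: val_inj; exact: e.
Qed.
End ResolutionExists.

Section LocalRings.
Variable R : comNzRingType.

Definition noetherian := forall I : ideal R, finitely_generated (ideal_module I).

Definition maximal_ideal (m : idealr R) :=
  forall n : idealr R, {subset m <= n} -> {subset n <= m}.

(* R is local and m is its maximal ideal; ideals are compared extensionally. *)
Definition local_with (m : idealr R) :=
  maximal_ideal m /\ forall n : idealr R, maximal_ideal n -> n =i m.

Definition has_prime_chain (n : nat) :=
  exists p : 'I_n.+1 -> prime_idealr R, forall i j : 'I_n.+1, (i < j)%N ->
    {subset p i <= p j} /\ exists2 x, x \in p j & x \notin p i.

Definition krull_dim (d : nat) :=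
  has_prime_chain d /\ forall n, has_prime_chain n -> (n <= d)%N.

Definition in_span (s : seq R) (a : R) :=
  exists c : 'I_(size s) -> R, a = \sum_i c i * s`_i.

Definition regular_sequence (s : seq R) :=
  (forall i, (i < size s)%N -> forall a,
     in_span (take i s) (s`_i * a) -> in_span (take i s) a)
  /\ ~ in_span s 1.

Definition depth (m : idealr R) (d : nat) :=
  (exists s : seq R, [/\ size s = d, {subset s <= m} & regular_sequence s])
  /\ forall s : seq R,
       {subset s <= m} -> regular_sequence s -> (size s <= d)%N.

Definition cohen_macaulay_local :=
  noetherian /\ exists m : idealr R, local_with m /\
    exists d, krull_dim d /\ depth m d.

Definition positive_grade (I : ideal R) := exists2 s, s \in I & GRing.lreg s.

End LocalRings.

(* Q is the localization of R at its nonzerodivisors. *)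
Definition total_quotient_ring (R : comNzRingType) (Q : comUnitRingType)
    (iota : {rmorphism R -> Q}) :=
  [/\ injective iota,
      forall s, GRing.lreg s -> iota s \is a GRing.unit
    & forall q, exists a s, GRing.lreg s /\ q = iota a / iota s].

Definition tensor_product (R : comNzRingType) (A B T : lmodType R)
    (t : {bilinear A -> B -> T}) :=
  forall (P : lmodType R) (b : {bilinear A -> B -> P}),
    exists! f : {linear T -> P}, forall x y, f (t x y) = b x y.

(* T is M (x)_R Q, given by the universal property of the tensor product of
   R-modules, with Q acting on the second factor. *)
Definition has_rank (R : comNzRingType) (M : lmodType R) (r : nat) :=
  exists (Q : comUnitRingType) (iota : {rmorphism R -> Q}) (T : lmodType Q)
         (t : {bilinear M -> restrict iota Q^o -> restrict iota T}),
    [/\ total_quotient_ring iota, tensor_product t,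
        forall (x : M) (p q : Q), t x (p * q) = p *: (t x q : T)
      & isomorphic 'rV[Q]_r T].

(* Main.v *)
Require Import Defs.
From HB Require Import structures.
From mathcomp Require Import all_boot all_algebra.
From mathcomp Require Import ring_quotient sesquilinear.
From mathcomp Require Import boolp functions prodnormedzmodule.
From mathcomp Require Import classical_sets.
From mathcomp Require Import ring.

(** Write Z for the center of End(M), m for the maximal ideal of R and x for a
    regular element of m. As R has dimension one, every element of m is nilpotent
    modulo x, so that every nonzero module N / x N has a nonzero socle. As
    Ext^1(M, M) = 0, the map End(M) -> End(M / x M) is surjective. Modules N / x N
    are not formed: maps into them are replaced by maps into N that are linear
    modulo x N (linear_modulo), and lift_linear_modulo is the lifting statement.

    Lifting the endomorphisms y |-> phi(y) s of M / x M, where phi : M -> R / m is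
    a functional and s lies in the socle, produces endomorphisms of M, which
    commute with Z. It follows (residue_exists) that Z acts on M / m M and on the
    socle of M / x M through one character Z -> R / m. Let n be its kernel; thus
    Z = R + n and n M is contained in m M, whence the elements of n are nilpotent
    modulo m Z by Cayley-Hamilton. If n is contained in m Z then Z = R + m Z, and
    Z = R by Nakayama's lemma. This inclusion is how (1) and (2) are used; from (3)
    one deduces that M is cyclic, so that Z = R as well.

    (1) If M is reflexive over Z and s / x is a fraction that is not in Z, some
    functional f : M -> Z and some y satisfy s f(y) / x not in Z: otherwise
    multiplication by s / x preserves the dual of M, hence its bidual M, so s / x
    is a central endomorphism (reflexive_trace). For s in the socle of Z / x Z this
    says that w = f(y) is not in n. But n w is contained in f(m M), hence in m Z,
    and w is invertible modulo m Z.

    (2) If n is not contained in m Z, there is a nonzero derivation d : Z -> R / m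
    over R at the character of Z (residue_derivation). It defines a Z-linear map
    from the syzygy L of M over Z to M / x M, sending a relation with coefficients
    l_y to sum_y d(l_y) phi(y) s. As Ext^2_Z(M, M) = 0 it lifts to a map H from L to
    M. On relations with coefficients in R the map H takes values in x M, and
    Ext^1_R(M, M) = 0 makes H / x extend from them to the free module. As M has a
    rank, Z has a common denominator in R, so that this extension computes H / x on
    all of L, and d is zero: a contradiction.

    (3) If M = I, lifting along the ring End(I) the map that sends a to the lift of
    b |-> phi_i(a) phi_j(b) s, for two coordinates i, j with respect to a minimal
    system of generators, gives H : I -> End(I) with H(a)(b) = phi_i(a) phi_j(b) s
    modulo x I. Such an H is a multiplication of fractions, so H(a)(b) is symmetric
    in a and b, which forces i = j: the ideal is principal.

    Finally, if Z = R and M is reflexive over R, the argument of (1) over R provides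
    a functional on M with a unit among its values, which splits off a copy of R. *)

Set Implicit Arguments.
Unset Strict Implicit.
Unset Printing Implicit Defensive.

Import GRing.Theory.
Local Open Scope ring_scope.

Definition linear_of (S : pzRingType) (A B : lmodType S) (f : A -> B) (lf : linear f) :
    {linear A -> B} :=
  HB.pack f (GRing.isLinear.Build S A B _ f lf).

(** * Ideals avoiding a multiplicative set *)

Definition is_ideal (R : pzRingType) (J : R -> Prop) :=
  J 0 /\ forall a b c, J b -> J c -> J (a * b + c).

Section IdealAvoidance.
Variable R : comNzRingType.
Implicit Types (J p W : R -> Prop).

Definition avoids W p := forall w, W w -> ~ p w.

Lemma ideal_of_pred J : is_ideal J -> ~ J 1 ->
  exists I : idealr R, forall a, (a \in I) <-> J a.
Proof.
move=> [J0 JP] J1.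
have cl : idealr_closed (fun a => `[< J a >] : bool).
  split; [exact/asboolP | exact/asboolP|].
  by move=> a u v /asboolP Ju /asboolP Jv; apply/asboolP; apply: JP.
pose I : idealr R := HB.pack (fun a => `[< J a >] : bool) (isIdealr.Build R _ cl).
by exists I => a; split=> [/asboolP|Ja]; last exact/asboolP.
Qed.

Lemma maximal_avoiding_ideal J W : is_ideal J -> avoids W J ->
  exists p, [/\ is_ideal p, forall a, J a -> p a, avoids W p
    & forall q, is_ideal q -> (forall a, p a -> q a) -> avoids W q ->
        forall a, q a -> p a].
Proof.
move=> idJ WJ.
pose P (A : set R) := A = set0 \/
  [/\ is_ideal A, (forall a, J a -> A a) & avoids W A].
have [F FP Ftot|A [PA maxA]] := @Zorn_bigcup R P.
  have [[A0 FA0 nA0]|noF] :=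
      pselect (exists2 A : set R, F A & A <> set0); last first.
    left; apply/seteqP; split=> [a [A FA Aa]|a []] //.
    have [//|nA] := pselect (A = set0).
      by move=> A0; rewrite A0 in Aa.
    by case: noF; exists A.
  right.
  have [//|[[A00 A0P] JA0 WA0]] := FP _ FA0.
  split.
  - split; first by exists A0.
    move=> a b c [B FB Bb] [C FC Cc].
    have /orP hBC : `[< (B `<=` C)%classic >] || `[< (C `<=` B)%classic >].
      by have [s|s] := Ftot _ _ FB FC; apply/orP; [left|right]; apply/asboolP.
    case: hBC => /asboolP s.
      exists C => //; have [C0|[[_ CP] _ _]] := FP _ FC.
        by rewrite C0 in Cc.
      by apply: CP => //; apply: s.
    exists B => //; have [B0|[[_ BP] _ _]] := FP _ FB.
      by rewrite B0 in Bb.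
    by apply: BP => //; apply: s.
  - by move=> a Ja; exists A0 => //; apply: JA0.
  - move=> w Ww [B FB Bw]; have [B0|[_ _ WB]] := FP _ FB.
      by rewrite B0 in Bw.
    exact: WB Bw.
have PJ : P J by right; split.
have [A0|[idA JA WA]] := PA.
  exfalso; apply: (maxA J) PJ; rewrite A0; split; first by move=> a [].
  by move=> /(_ 0); apply; case: idJ.
exists A; split=> // q idq Aq Wq a qa.
apply: contrapT => nAa; apply: (maxA q); last by right; split=> // b /JA /Aq.
by split=> [b /Aq//|/(_ a qa)].
Qed.

Lemma maximal_avoiding_prime J W :
    (forall u v, W u -> W v -> W (u * v)) -> is_ideal J ->
    avoids W J ->
  exists p, [/\ is_ideal p, forall a, J a -> p a, avoids W p
    & forall u v, p (u * v) -> p u \/ p v].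
Proof.
move=> WM idJ WJ; have [p [idp Jp Wp maxp]] := maximal_avoiding_ideal idJ WJ.
exists p; split=> // u v puv; apply: contrapT => /not_orP [npu npv].
have [p0 pP] := idp.
have pD a b : p a -> p b -> p (a + b) by move=> pa pb; rewrite -[a]mul1r; apply: pP.
have pM a b : p b -> p (a * b) by move=> pb; rewrite -[_ * _]addr0; apply: pP.
have meet z : ~ p z -> exists a b, p a /\ W (a + b * z).
  move=> npz; apply: contrapT => nex; apply: npz.
  apply: (maxp (fun c => exists a b, p a /\ c = a + b * z)).
  - split; first by exists 0, 0; rewrite mul0r addr0.
    move=> a _ _ [a1 [b1 [pa1 ->]]] [a2 [b2 [pa2 ->]]].
    exists (a * a1 + a2), (a * b1 + b2); split; first exact: pP.
    by rewrite mulrDr mulrDl !mulrA addrACA.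
  - by move=> a pa; exists a, 0; rewrite mul0r addr0.
  - by move=> w Ww [a [b [pa e]]]; apply: nex; exists a, b; rewrite -e.
  - by exists 0, 1; rewrite mul1r add0r.
have [a [b [pa Wa]]] := meet u npu; have [c [d [pc Wc]]] := meet v npv.
apply: (Wp _ (WM _ _ Wa Wc)); rewrite mulrDr; apply/(pD); first exact: pM.
rewrite mulrDl; apply/(pD); first by rewrite mulrC; apply: pM.
by rewrite mulrACA; apply: pM.
Qed.
End IdealAvoidance.

(** * Parameters of one-dimensional Cohen-Macaulay local rings *)

(** What is used of a one-dimensional Cohen-Macaulay local ring; parameter_nil
    says that R / x R is Artinian. *)
Record local_parameter (R : comNzRingType) (m : idealr R) (x : R) : Prop :=
  LocalParameter {
    local_unit : forall u, u \notin m -> exists v, v * u = 1;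
    local_fg : exists n (a : 'I_n -> R), (forall i, a i \in m) /\
      forall c, c \in m -> exists b : 'I_n -> R, c = \sum_i b i * a i;
    parameter_mem : x \in m;
    parameter_reg : GRing.lreg x;
    parameter_nil : forall a, a \in m -> exists k b, a ^+ k = x * b }.

Section LocalRing.
Variable R : comNzRingType.
Implicit Types (m : idealr R) (J p W : R -> Prop).

Lemma local_nonmember_unit m u : local_with m -> u \notin m -> exists v, v * u = 1.
Proof.
move=> [maxm um] num; apply: contrapT => nu.
have idu : is_ideal (fun c => exists v, c = v * u).
  split; first by exists 0; rewrite mul0r.
  by move=> a _ _ [v ->] [w ->]; exists (a * v + w); rewrite mulrDl mulrA.
have Wu : avoids (fun w => w = 1) (fun c => exists v, c = v * u).
  by move=> _ -> [v e]; apply: nu; exists v.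
have [p [idp up Wp maxp]] := maximal_avoiding_ideal idu Wu.
have [n np] := ideal_of_pred idp (Wp 1 erefl).
have maxn : maximal_ideal n.
  move=> n' nn' a an'; apply/np; apply: (maxp (fun a => a \in n')) => //.
  - split; first exact: rpred0.
    by move=> a0 b c bn cn; rewrite rpredD ?idealMr.
  - by move=> b /np /nn'.
  - by move=> _ ->; rewrite idealr1.
by case/negP: num; rewrite -(um n maxn); apply/np; apply: up; exists 1; rewrite mul1r.
Qed.

(** If no power of a is in x R, some prime p contains x and avoids the powers of a.
    As x is regular, some prime inside p avoids x, and with p and m it forms a
    chain of length two. *)
Lemma dim1_parameter_nil m x :
    (forall u, u \notin m -> exists v, v * u = 1) -> krull_dim R 1 ->
    x \in m -> GRing.lreg x ->
  forall a, a \in m -> exists k b, a ^+ k = x * b.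
Proof.
move=> unitm [_ dim1] xm regx a am; apply: contrapT => nnil.
have idx : is_ideal (fun c => exists b, c = x * b).
  split; first by exists 0; rewrite mulr0.
  move=> c _ _ [b1 ->] [b2 ->]; exists (c * b1 + b2).
  by rewrite mulrDr mulrCA.
have Wx : avoids (fun w => exists k, w = a ^+ k) (fun c => exists b, c = x * b).
  by move=> _ [k ->] [b e]; apply: nnil; exists k, b.
have WM u v : (exists k, u = a ^+ k) -> (exists k, v = a ^+ k) ->
    exists k, u * v = a ^+ k.
  by move=> [k ->] [l ->]; exists (k + l)%N; rewrite exprD.
have [p [idp xp Wp primep]] := maximal_avoiding_prime WM idx Wx.
have np1 : ~ p 1 by apply: Wp; exists 0; rewrite expr0.
have npa : ~ p a by apply: Wp; exists 1; rewrite expr1.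
have px : p x by apply: xp; exists 1; rewrite mulr1.
(* a prime avoiding V is contained in p and does not contain x *)
pose V w := exists i b, ~ p b /\ w = x ^+ i * b.
have VM u v : V u -> V v -> V (u * v).
  move=> [i [b [npb ->]]] [j [c [npc ->]]]; exists (i + j)%N, (b * c).
  by split; [case/primep|rewrite exprD mulrACA].
have id0 : is_ideal (fun c : R => c = 0).
  by split=> // c _ _ -> ->; rewrite mulr0 addr0.
have V0 : avoids V (fun c => c = 0).
  move=> _ [i [b [npb ->]]] e; apply: npb.
  have -> : b = 0.
    elim: i e => [|i IHi]; first by rewrite expr0 mul1r.
    by rewrite exprS -mulrA => e; apply/IHi/regx; rewrite e mulr0.
  by case: idp.
have [q [idq _ Vq primeq]] := maximal_avoiding_prime VM id0 V0.
have npx : ~ q x by apply: Vq; exists 1, 1; rewrite mulr1.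
have nq1 : ~ q 1 by apply: Vq; exists 0, 1; rewrite mulr1.
have qp b : q b -> p b.
  move=> qb; apply: contrapT => npb; apply: (Vq b) qb.
  by exists 0, b; rewrite mul1r.
have [Ip IpP] := ideal_of_pred idp np1; have [Iq IqP] := ideal_of_pred idq nq1.
have mkprime (I : idealr R) : (forall u v, u * v \in I -> u \in I \/ v \in I) ->
    exists I' : prime_idealr R, I' =i I.
  move=> primeI.
  have cl : prime_idealr_closed I by move=> u v /primeI/orP.
  pose I' : prime_idealr R := HB.pack (I : R -> bool)
    (isPrimeIdealrClosed.Build R I cl) (Idealr.on I).
  by exists I'.
have [p' p'P] : exists I' : prime_idealr R, I' =i Ip.
  by apply: mkprime => u v /IpP /primep [h|h]; [left|right]; apply/IpP.
have [q' q'P] : exists I' : prime_idealr R, I' =i Iq.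
  by apply: mkprime => u v /IqP /primeq [h|h]; [left|right]; apply/IqP.
have [m' m'P] : exists I' : prime_idealr R, I' =i m.
  apply: mkprime => u v uvm; apply: contrapT => /not_orP [/negP /unitm [u' u'u] nv].
  by apply: nv; rewrite -[v]mul1r -u'u -mulrA idealMr.
have pm b : b \in p' -> b \in m'.
  rewrite p'P m'P => /IpP pb; apply: contrapT => /negP /unitm [v vb].
  apply: np1; rewrite -vb -[_ * _]addr0; have [p0 pP] := idp; exact: pP.
suff : has_prime_chain R 2 by move/dim1.
exists (fun i : 'I_3 => nth m' [:: q'; p'; m'] i).
have e1 : {subset q' <= p'} /\ exists2 y, y \in p' & y \notin q'.
  split; first by move=> b; rewrite q'P p'P => /IqP /qp /IpP.
  by exists x; rewrite ?p'P ?q'P; [apply/IpP|apply/negP => /IqP].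
have e2 : {subset p' <= m'} /\ exists2 y, y \in m' & y \notin p'.
  split=> //.
  by exists a; rewrite ?p'P ?m'P //; apply/negP => /IpP.
move=> [[|[|[|i]]] hi] [[|[|[|j]]] hj] //= _; split.
- by move=> b /(proj1 e1) /(proj1 e2).
- by case: e1 => _ [y yp yq]; exists y => //; apply: pm.
Qed.

Lemma CM_dim1_parameter : cohen_macaulay_local R -> krull_dim R 1 ->
  exists m x, @local_parameter R m x.
Proof.
move=> [noeth [m [locm [d [dimd [[s [ss sm regs]] _]]]]]] dim1.
have {d dimd}ss : size s = 1.
  rewrite ss; apply/eqP; rewrite eqn_leq.
  by case: dimd dim1 => cd bd [c1 b1]; rewrite b1 // bd.
case: s ss sm regs => [|x []] // _ sm [regs _].
have xm : x \in m by apply: sm; rewrite inE.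
have regx : GRing.lreg x.
  have h a : x * a = 0 -> a = 0.
    move=> xa0; have [|c ->] := regs 0 isT a; last by rewrite big_ord0.
    by exists (fun=> 0); rewrite big_ord0 /= xa0.
  by move=> a b /eqP; rewrite -subr_eq0 -mulrBr => /eqP /h /eqP; rewrite subr_eq0 => /eqP.
have um u := @local_nonmember_unit m u locm.
exists m, x; split=> //; last exact: dim1_parameter_nil.
have cl : submod_closed (m : pred R^o).
  by split=> [|a u v um' vm']; rewrite ?rpred0 // rpredD // idealMr.
pose I : ideal R := HB.pack (m : R^o -> bool) (GRing.isSubmodClosed.Build R R^o m cl).
have [n [e eP]] := noeth I.
exists n, (fun i => val (e i)); split=> [i|c cm]; first exact: valP (e i).
have [b /(congr1 val)] := eP (exist (fun y : R^o => y \in I) c cm).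
rewrite linear_sum /= => ->; exists b; exact: eq_bigr.
Qed.
End LocalRing.

(** * Finitely generated modules over a local ring *)

(** The submodule m A, presented inductively so that its closure properties need no
    finite families. *)
Inductive in_mul (R : nzRingType) (m : idealr R) (A : lmodType R) : A -> Prop :=
| InMul0 : in_mul m 0
| InMulS a u v : a \in m -> in_mul m v -> in_mul m (a *: u + v).

Definition multiple (S : pzRingType) (A : lmodType S) (x : S) (y : A) :=
  exists w, y = x *: w.

(** With P the membership in a submodule B' of B, the map h stands for a linear map
    from A to B / B'. *)
Definition linear_modulo (S : pzRingType) (A B : lmodType S) (P : B -> Prop) (h : A -> B) :=
  forall a u v, P (h (a *: u + v) - (a *: h u + h v)).

Definition generators (S : pzRingType) (A : lmodType S) n (e : 'I_n -> A) :=
  forall y, exists c : 'I_n -> S, y = \sum_i c i *: e i.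

(** For a local ring, asking that relations have coefficients in m amounts to
    asking that no generator is redundant. *)
Definition minimal_generators (R : nzRingType) (m : idealr R) (A : lmodType R)
    n (e : 'I_n -> A) :=
  generators e /\ forall c : 'I_n -> R, \sum_i c i *: e i = 0 -> forall i, c i \in m.

(** Coordinates with respect to e are chosen in R; they are well defined, and linear,
    modulo m. *)
Definition coordinates_modulo (R : nzRingType) (m : idealr R) (A : lmodType R)
    n (e : 'I_n -> A) (phi : A -> 'I_n -> R) :=
  (forall y, y = \sum_i phi y i *: e i) /\
  forall y (d : 'I_n -> R), in_mul m (y - \sum_i d i *: e i) ->
    forall i, phi y i - d i \in m.

Section Multiple.
Variables (S : pzRingType) (A : lmodType S) (x : S).

Lemma multiple0 : multiple x (0 : A).
Proof. by exists 0; rewrite scaler0. Qed.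

Lemma multipleD (u v : A) : multiple x u -> multiple x v -> multiple x (u + v).
Proof. by move=> [w ->] [w' ->]; exists (w + w'); rewrite scalerDr. Qed.

Lemma multipleN (u : A) : multiple x u -> multiple x (- u).
Proof. by move=> [w ->]; exists (- w); rewrite scalerN. Qed.

Lemma multipleB (u v : A) : multiple x u -> multiple x v -> multiple x (u - v).
Proof. by move=> xu xv; apply/multipleD/multipleN. Qed.

Lemma multiple_sym (u v : A) : multiple x (u - v) -> multiple x (v - u).
Proof. by move=> /multipleN; rewrite opprB. Qed.

Lemma multiple_trans (v u w : A) :
  multiple x (u - v) -> multiple x (v - w) -> multiple x (u - w).
Proof. by move=> uv /(multipleD uv); rewrite addrA subrK. Qed.

Lemma multiple_add (u v u' v' : A) :
  multiple x (u - v) -> multiple x (u' - v') -> multiple x (u + u' - (v + v')).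
Proof. by move=> uv /(multipleD uv); rewrite opprD addrACA. Qed.

Lemma multiple_sum (I : Type) (r : seq I) (F : I -> A) :
  (forall i, multiple x (F i)) -> multiple x (\sum_(i <- r) F i).
Proof.
move=> xF; elim: r => [|i r IHr]; first by rewrite big_nil; apply: multiple0.
by rewrite big_cons; apply: multipleD.
Qed.
End Multiple.

Lemma multipleZ (S : comPzRingType) (A : lmodType S) (x a : S) (u : A) :
  multiple x u -> multiple x (a *: u).
Proof. by move=> [w ->]; exists (a *: w); rewrite !scalerA mulrC. Qed.

Section InMul.
Variables (R : comNzRingType) (m : idealr R).

Lemma in_mulD (A : lmodType R) (u v : A) : in_mul m u -> in_mul m v -> in_mul m (u + v).
Proof.
elim=> [|a w t am _ IH] mv; first by rewrite add0r.
by rewrite -addrA; apply: InMulS => //; apply: IH.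
Qed.

Lemma in_mulZ (A : lmodType R) a (u : A) : in_mul m u -> in_mul m (a *: u).
Proof.
elim=> [|b w t bm _ IH]; first by rewrite scaler0; constructor.
by rewrite scalerDr scalerA; apply: InMulS => //; apply: idealMr.
Qed.

Lemma in_mulB (A : lmodType R) (u v : A) : in_mul m u -> in_mul m v -> in_mul m (u - v).
Proof. by move=> mu mv; rewrite -scaleN1r; apply/in_mulD/in_mulZ. Qed.

Lemma in_mul_scale (A : lmodType R) a (u : A) : a \in m -> in_mul m (a *: u).
Proof. by move=> am; rewrite -[_ *: _]addr0; apply: InMulS => //; constructor. Qed.

Lemma in_mul_sum (A : lmodType R) (I : Type) (r : seq I) (F : I -> A) :
  (forall i, in_mul m (F i)) -> in_mul m (\sum_(i <- r) F i).
Proof.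
move=> mF; elim: r => [|i r IHr]; first by rewrite big_nil; constructor.
by rewrite big_cons; apply: in_mulD.
Qed.

Lemma in_mul_image (A B : lmodType R) (f : A -> B) (u : A) :
  linear f -> in_mul m u -> in_mul m (f u).
Proof.
move=> lf; elim=> [|a v w am _ IH].
  by have := lf (-1) 0 0; rewrite scaleN1r !scaleN1r oppr0 addr0 addNr => ->; constructor.
by rewrite lf; apply: InMulS.
Qed.

Lemma in_mul_coef (A : lmodType R) n (e : 'I_n -> A) (u : A) :
    generators e -> in_mul m u ->
  exists c : 'I_n -> R, (forall i, c i \in m) /\ u = \sum_i c i *: e i.
Proof.
move=> ge; elim=> [|a v w am _ [c [cm ->]]].
  by exists (fun=> 0); split=> [i|]; rewrite ?rpred0 // big1 // => i _; rewrite scale0r.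
have [d ->] := ge v; exists (fun i => a * d i + c i); split=> [i|].
  by rewrite rpredD // mulrC idealMr.
rewrite scaler_sumr -big_split; apply: eq_bigr => i _.
by rewrite scalerDl scalerA.
Qed.
End InMul.

Section CommonSocle.
Variables (T : Type) (zero good : T -> Prop) (n : nat) (op : 'I_n -> T -> T).
Hypothesis opC : forall i j t, op i (op j t) = op j (op i t).
Hypothesis op_zero : forall i t, zero t -> zero (op i t).
Hypothesis op_good : forall i t, good t -> good (op i t).
Hypothesis op_nil : forall i t, good t -> exists k, zero (iter k (op i) t).

(** Commuting nilpotent operators have a common kernel vector: apply to t0 as high a
    power of each operator in turn as does not give zero. The predicate good
    delimits the vectors that matter when T is too large a type. *)
Lemma common_socle t0 : good t0 -> ~ zero t0 ->
  exists s, [/\ good s, ~ zero s & forall i, zero (op i s)].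
Proof.
move=> gt0 nt0.
suff /(_ n (leqnn n)) [s [gs ns hs]] : forall k, (k <= n)%N ->
    exists s, [/\ good s, ~ zero s & forall i : 'I_n, (i < k)%N -> zero (op i s)].
  by exists s; split=> // i; apply: hs.
elim=> [_|k IHk kn]; first by exists t0.
have [s [gs ns hs]] := IHk (ltnW kn); pose f := op (Ordinal kn).
have [l zl] := op_nil (Ordinal kn) gs.
suff [u [gu nu hu zu]] : exists u, [/\ good u, ~ zero u,
    forall i : 'I_n, (i < k)%N -> zero (op i u) & zero (f u)].
  exists u; split=> // i; rewrite ltnS leq_eqVlt => /orP [/eqP ik|]; last exact: hu.
  by have -> : i = Ordinal kn by apply: val_inj.
elim: l s gs ns hs zl => [//|l IHl] s gs ns hs zl.
have [zf|nf] := pselect (zero (f s)); first by exists s.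
apply: (IHl (f s)) => //; first exact: op_good.
  by move=> i ik; rewrite /f opC; apply/op_zero/hs.
by rewrite -iterSr.
Qed.
End CommonSocle.

Section LocalModules.
Variables (R : comNzRingType) (m : idealr R) (x : R).
Hypothesis lp : local_parameter m x.

Lemma minimal_generators_exist (A : lmodType R) : finitely_generated A ->
  exists n (e : 'I_n -> A), minimal_generators m e.
Proof.
move=> [n0 [e0 g0]].
pose P n := `[< exists e : 'I_n -> A, generators e >].
have exP : exists n, P n by exists n0; apply/asboolP; exists e0.
case: (ex_minnP exP) => n /asboolP [e ge] minn.
exists n, e; split=> // c rel i; apply: contrapT => /negP /(local_unit lp) [v vc].
case: n e ge minn c rel i vc => [|n] e ge minn c rel i vc; first by case: (i).
suff /minn : P n by rewrite ltnn.
apply/asboolP; exists (fun j => e (lift i j)) => y; have [d ->] := ge y.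
have ei : e i = \sum_j (- (v * c (lift i j))) *: e (lift i j).
  have /(congr1 (fun u => v *: u)) := rel.
  rewrite (bigD1_ord i) //= scaler0 scalerDr scalerA vc scale1r => /eqP.
  rewrite addr_eq0 => /eqP ->; rewrite scaler_sumr -sumrN.
  by apply: eq_bigr => j _; rewrite scalerA scaleNr.
exists (fun j => d i * (- (v * c (lift i j))) + d (lift i j)).
rewrite (bigD1_ord i) //= ei scaler_sumr -big_split /=.
by apply: eq_bigr => j _; rewrite scalerDl scalerA.
Qed.

Lemma minimal_coordinates (A : lmodType R) n (e : 'I_n -> A) :
    minimal_generators m e ->
  exists phi, coordinates_modulo m e phi.
Proof.
move=> [ge me]; have [phi phiP] := choice ge; exists phi; split=> // y d yd i.
have [c [cm e0]] := in_mul_coef ge yd.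
rewrite -[phi y i - d i](addrNK (c i)) rpredD //.
apply: (me (fun i => phi y i - d i - c i)).
rewrite [X in X - _]phiP in e0.
transitivity (\sum_i phi y i *: e i - \sum_i d i *: e i - \sum_i c i *: e i); last first.
  by rewrite e0 subrr.
rewrite -!sumrB; apply: eq_bigr => j _.
by rewrite !scalerBl.
Qed.

Lemma sum_delta_scale (A : lmodType R) n (e : 'I_n -> A) j :
  \sum_i (i == j)%:R *: e i = e j.
Proof.
rewrite (bigD1 j) //= eqxx scale1r big1 ?addr0 // => i /negPf ->.
by rewrite scale0r.
Qed.

Section Coordinates.
Variables (A : lmodType R) (n : nat) (e : 'I_n -> A) (phi : A -> 'I_n -> R).
Hypothesis phiP : coordinates_modulo m e phi.

Lemma coordinates_generator i j : phi (e j) i - (i == j)%:R \in m.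
Proof.
apply: (phiP.2 _ (fun i => (i == j)%:R)).
by rewrite sum_delta_scale subrr; constructor.
Qed.

Lemma coordinates_linear i a u v : phi (a *: u + v) i - (a * phi u i + phi v i) \in m.
Proof.
apply: (phiP.2 _ (fun i => a * phi u i + phi v i)).
rewrite [X in in_mul m (X - _)](_ : _ = \sum_i (a * phi u i + phi v i) *: e i).
  by rewrite subrr; constructor.
rewrite {1}(phiP.1 u) {1}(phiP.1 v) scaler_sumr -big_split; apply: eq_bigr => j _.
by rewrite scalerA scalerDl.
Qed.

Lemma coordinates_scale i y z r :
  in_mul m (z - r *: y) -> phi z i - r * phi y i \in m.
Proof.
move=> h; apply: (phiP.2 _ (fun i => r * phi y i)).
rewrite (_ : \sum_i _ = r *: y) // {2}(phiP.1 y) scaler_sumr.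
by apply: eq_bigr => j _; rewrite scalerA.
Qed.
End Coordinates.

Lemma local_unit_near1 a : a \in m -> exists v, v * (1 - a) = 1.
Proof.
move=> am; apply: (local_unit lp); apply/negP => h.
by have := rpredD am h; rewrite addrC subrK idealr1.
Qed.

Lemma nonmultiple_generator (A : lmodType R) n (e : 'I_n -> A) i :
  minimal_generators m e -> ~ multiple x (e i).
Proof.
move=> [ge me] [w ew]; have [c wE] := ge w.
have := me (fun j => (j == i)%:R - x * c j).
move=> /(_ _ i) /= h.
have : (i == i)%:R - x * c i \in m.
  apply: h; transitivity (e i - x *: w); last by rewrite ew subrr.
  rewrite [in RHS]wE scaler_sumr -[in X in _ = X]sumrN.
  rewrite -[in RHS](sum_delta_scale e i).
  by rewrite -big_split; apply: eq_bigr => j _; rewrite scalerBl scalerA.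
rewrite eqxx => h1.
have := rpredD h1 (idealMr (c i) (parameter_mem lp)).
by rewrite [c i * x]mulrC subrK idealr1.
Qed.

(** The generators of m act nilpotently on A / x A, because they are nilpotent modulo
    x. *)
Lemma socle_modulo_parameter (A : lmodType R) (u : A) : ~ multiple x u ->
  exists s : A, ~ multiple x s /\ forall a, a \in m -> multiple x (a *: s).
Proof.
move=> nu; have [n [a [am agen]]] := local_fg lp.
have [| | | |s [_ ns hs]] := @common_socle A (multiple x) (fun=> True) n
    (fun i y => a i *: y) _ _ _ _ u I nu.
- by move=> i j t; rewrite !scalerA mulrC.
- by move=> i t; apply: multipleZ.
- by [].
- move=> i t _; have [k [b e]] := parameter_nil lp (am i).
  exists k; exists (b *: t); rewrite scalerA -e.
  by elim: k {e} => [|k IHk]; rewrite ?scale1r //= IHk scalerA exprS.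
exists s; split=> // c /agen [b ->]; rewrite scaler_suml.
by apply: multiple_sum => i; rewrite -scalerA; apply: multipleZ.
Qed.

(** Nakayama's lemma in the cyclic case. The coordinates of the i-th of n minimal
    generators form the i-th unit vector and are r_i times those of u; hence the
    identity matrix has rank at most one over the residue field. *)
Lemma cyclic_modulo_maximal (A : lmodType R) (u : A) :
    finitely_generated A -> (forall y, exists r : R, in_mul m (y - r *: u)) ->
  forall y, exists r : R, y = r *: u.
Proof.
move=> /minimal_generators_exist [n [e mine]] cyc.
have [phi phiP] := minimal_coordinates mine.
have [r rP] := choice (fun i => cyc (e i)).
(* modulo m, the vector of coordinates of e i is r i times that of u *)
have key i j : (j == i)%:R - r i * phi u j \in m.
  have h1 := coordinates_generator phiP j i.
  have h2 := coordinates_scale phiP j (rP i).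
  have -> : (j == i)%:R - r i * phi u j = (phi (e i) j - r i * phi u j) -
      (phi (e i) j - (j == i)%:R) by ring.
  exact: rpredB.
have unit_of a b : 1 - a * b \in m -> exists v, v * b = 1.
  move=> h; have [v ve] := local_unit_near1 h.
  by exists (v * a); rewrite -mulrA -ve opprB addrC subrK.
case: n e mine phi phiP r rP key => [|[|n]] e mine phi phiP r rP key; have [phiE _] := phiP.
- by move=> y; exists 0; rewrite scale0r (phiE y) big_ord0.
- have := key ord0 ord0; rewrite eqxx => /unit_of [v ve] y.
  have eu : e ord0 = v *: u.
    by rewrite (phiE u) big_ord1 scalerA ve scale1r.
  by exists (phi y ord0 * v); rewrite {1}(phiE y) big_ord1 eu scalerA.
exfalso; pose i0 : 'I_n.+2 := ord0; pose i1 : 'I_n.+2 := lift ord0 ord0.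
have := key i0 i0; rewrite eqxx mulrC => /unit_of [v ve].
have := key i1 i1; rewrite eqxx => /unit_of [w we].
have := key i0 i1; rewrite sub0r rpredN => h.
by have := idealMr (v * w) h; rewrite mulrACA ve we mulr1 idealr1.
Qed.
End LocalModules.

(** * Vanishing of Ext and lifting modulo a central element *)

Section ExtExtension.
Variable S : pzRingType.
Implicit Types (A N : lmodType S).

(** The restriction from Hom(F, N) to Hom(K, N) is onto, where F is the standard free
    cover of A and K its kernel: this is the vanishing of the first Ext of A and N. *)
Definition extends_from_syzygy A N :=
  forall k : {linear syzygy A -> N},
    exists g : {linear free_module S A -> N}, forall l, k l = g (val l).

Lemma free_diff_exactS A (x : free_module S (syzygy A)) :
  free_diff A x = 0 <-> exists y, free_diff (syzygy A) y = x.
Proof.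
rewrite -(@free_diff_exact _ (syzygy A) x) /=.
by split=> [e|->]; [apply: val_inj|].
Qed.

Definition free_resolution A : projective_resolution A :=
  @ProjectiveResolution S A (fun n => free_module S (syzygies A n))
    (fun n => free_diff (syzygies A n)) (free_cover A)
    (fun n => @free_projective S (syzygies A n)) (@free_cover_surj S A)
    (@free_diff_exact S A) (fun n => @free_diff_exactS (syzygies A n)).

(** Dimension shifting along the standard free resolution. *)
Lemma Ext_vanishes_extends n A N :
  Ext_vanishes n.+1 A N -> extends_from_syzygy (syzygies A n) N.
Proof.
move=> ext k.
pose f : {linear res_term (free_resolution A) n.+1 -> N} :=
  (k \o free_cover (syzygies A n.+1)).
have cf : cocycle f.
  move=> y; rewrite /f /=.
  have -> : free_lift (fun x => x) (val (free_lift (fun x => x) y)) = 0 :> syzygies A n.+1.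
    exact/eqP/(valP (free_cover (syzygies A n.+2) y)).
  exact: linear0.
have [g gP] := ext _ f cf; exists g => l.
have := gP (dirac S l).
by rewrite /f /= !free_lift_dirac.
Qed.

(** Surjectivity of Hom(A, N) -> Hom(A, N / x N). The map of the free cover of A
    extending h sends the syzygy into x N; dividing by x and extending gives the
    correction that makes it descend to A. *)
Lemma lift_linear_modulo A N (x : S) (h : A -> N) :
    (forall a : S, a * x = x * a) ->
    (forall y : N, x *: y = 0 -> y = 0) ->
    extends_from_syzygy A N -> linear_modulo (multiple x) h ->
  exists H : {linear A -> N}, forall y, multiple x (H y - h y).
Proof.
move=> xC xreg ext hlin.
have xZ a (y : N) : multiple x y -> multiple x (a *: y).
  by move=> [w ->]; exists (a *: w); rewrite !scalerA xC.
have h0 : multiple x (h 0).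
  have := hlin (-1) 0 0.
  by rewrite scaleN1r oppr0 addr0 scaleN1r addNr subr0.
have hcomb (s : seq A) (c : A -> S) :
    multiple x (h (\sum_(y <- s) c y *: y) - \sum_(y <- s) c y *: h y).
  elim: s => [|y s IHs]; first by rewrite !big_nil subr0.
  rewrite !big_cons; have /multipleD/(_ IHs) := hlin (c y) y (\sum_(y <- s) c y *: y).
  by rewrite !opprD !addrA subrK.
have kex (l : syzygy A) : exists w, free_lift h (val l) = x *: w.
  have /eqP l0 := valP l; have := hcomb (free_support (val l)) (coef (val l)).
  rewrite [X in h X](_ : _ = 0) // => /(multipleB h0).
  by rewrite opprB addrCA subrr addr0.
have [k kP] := choice kex.
have klin : linear k.
  move=> a u v; apply/eqP; rewrite -subr_eq0; apply/eqP/xreg.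
  rewrite scalerBr scalerDr scalerA -xC -scalerA -!kP.
  have -> : val (a *: u + v) = a *: val u + val v by [].
  by rewrite (linearP (free_lift h)) subrr.
pose kL : {linear syzygy A -> N} := linear_of klin.
have [g gP] := ext kL.
have {gP} G0 v : free_cover A v = 0 -> free_lift h v = x *: g v.
  move=> /eqP v0; pose l : syzygy A := exist (fun w => w \in @kernel_pred S A) v v0.
  by have := gP l; rewrite /= => <-; rewrite -kP.
pose H y := h y - x *: g (dirac S y).
have Hlin : linear H.
  move=> a u v; pose d := dirac S (a *: u + v) - (a *: dirac S u + dirac S v).
  have /G0 : free_cover A d = 0.
    by rewrite /d linearB linearP /= !free_lift_dirac subrr.
  rewrite /d (linearB (free_lift h)) (linearP (free_lift h)) /= !free_lift_dirac.
  rewrite (linearB g) (linearP g).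
  rewrite scalerBr scalerDr scalerA -xC -scalerA => e.
  move/eqP: e; rewrite subr_eq => /eqP e.
  rewrite /H e addrAC [_ - _ - _]addrAC subrr add0r.
  by rewrite scalerBr [RHS]addrACA -opprD addrC.
pose HL : {linear A -> N} := linear_of Hlin.
exists HL => y; rewrite /= /H addrAC subrr sub0r.
by apply: multipleN; exists (g (dirac S y)).
Qed.
End ExtExtension.

(** * The residue character of the center of the endomorphism ring *)

Definition homothety (R : comNzRingType) (M : lmodType R) (r : R) : Zend M :=
  r *: (1 : Zend M).

Section CentralAction.
Variables (R : comNzRingType) (M : lmodType R).
Implicit Types (z w : Zend M) (y : M).

Definition zact z : {linear M -> M} := (val z : End M).

Lemma zact_comm z (H : {linear M -> M}) y : zact z (H y) = H (zact z y).
Proof.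
have /centerP /(_ H) e := valP z.
exact/esym/(congr1 (fun h : End M => h y) e).
Qed.

Lemma zactD z w y : zact (z + w) y = zact z y + zact w y. Proof. by []. Qed.
Lemma zactM z w y : zact (z * w) y = zact z (zact w y). Proof. by []. Qed.
Lemma zactZ a z y : zact (a *: z) y = a *: zact z y. Proof. by []. Qed.
Lemma zact1 y : zact 1 y = y. Proof. by []. Qed.
Lemma zact0 y : zact 0 y = 0. Proof. by []. Qed.

Lemma zact_inj z w : (forall y, zact z y = zact w y) -> z = w.
Proof. by move=> e; apply/val_inj/linear_eqP. Qed.

Lemma zact_sum (I : Type) (r : seq I) (F : I -> Zend M) y :
  zact (\sum_(i <- r) F i) y = \sum_(i <- r) zact (F i) y.
Proof.
elim: r => [|i r IHr]; first by rewrite !big_nil.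
by rewrite !big_cons zactD IHr.
Qed.

Lemma Zend_scalerAl a z w : (a *: z) * w = a *: (z * w).
Proof. by apply: zact_inj => y. Qed.

Lemma Zend_scalerAr a z w : z * (a *: w) = a *: (z * w).
Proof. by rewrite mulrC Zend_scalerAl mulrC. Qed.

Lemma central_endomorphism (f : {linear M -> M}) :
    (forall (H : {linear M -> M}) y, f (H y) = H (f y)) ->
  exists z, forall y, zact z y = f y.
Proof.
move=> fC; have cf : (f : End M) \in ring_center (End M).
  by apply/centerP => H; apply: linear_eqP => y; apply: esym (fC H y).
by exists (exist (fun g : End M => g \in ring_center (End M)) f cf).
Qed.
End CentralAction.

Section Residue.
Variables (R : comNzRingType) (M : lmodType R) (m : idealr R) (x : R).
Hypothesis lp : local_parameter m x.
Variables (n : nat) (e : 'I_n.+1 -> M).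
Hypothesis mine : minimal_generators m e.
Hypothesis lift : forall h : M -> M, linear_modulo (multiple x) h ->
  exists H : {linear M -> M}, forall y, multiple x (H y - h y).
Implicit Types (z w : Zend M) (y s : M).

Definition in_socle s := forall a, a \in m -> multiple x (a *: s).

(** On M / m M the central endomorphism z is multiplication by r. *)
Definition residue z (r : R) := forall y, in_mul m (zact z y - r *: y).

Lemma residue_scalar r : residue (homothety M r) r.
Proof. by move=> y; rewrite zactZ zact1 subrr; constructor. Qed.

Lemma residueD z w r t : residue z r -> residue w t -> residue (z + w) (r + t).
Proof.
by move=> hz hw y; rewrite zactD scalerDl opprD addrACA; apply: in_mulD.
Qed.

Lemma residueB_scalar z r : residue z r -> residue (z - homothety M r) 0.
Proof.
move=> hz y; rewrite scale0r subr0 zactD.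
by have := hz y; rewrite (_ : zact (- (homothety M r)) y = - (r *: y)).
Qed.

Lemma residue0M z w : residue z 0 -> residue (w * z) 0.
Proof.
move=> hz y; rewrite scale0r subr0 zactM; apply: in_mul_image; first exact: linearP.
by have := hz y; rewrite scale0r subr0.
Qed.

Lemma residue0_in_mul z y : residue z 0 -> in_mul m (zact z y).
Proof. by move=> /(_ y); rewrite scale0r subr0. Qed.

Lemma residueZ a z r : residue z r -> residue (a *: z) (a * r).
Proof. by move=> hz y; rewrite zactZ -scalerA -scalerBr; apply: in_mulZ. Qed.

Lemma residueM z w r t : residue z r -> residue w t -> residue (z * w) (r * t).
Proof.
move=> hz hw y; rewrite zactM -[zact z _](subrK (t *: zact z y)) -addrA.
apply: in_mulD.
  by rewrite -linearZ -linearB; apply: in_mul_image; [exact: linearP|exact: hw].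
by rewrite mulrC -scalerA -scalerBr; apply: in_mulZ.
Qed.

Lemma scalar_in_maximal r : (forall y : M, in_mul m (r *: y)) -> r \in m.
Proof.
move=> h; have [c [cm rE]] := in_mul_coef mine.1 (h (e ord0)).
suff /(mine.2) /(_ ord0) : \sum_i (r * (i == ord0)%:R - c i) *: e i = 0.
  by rewrite eqxx mulr1 => /(rpredD (cm ord0)); rewrite addrC subrK.
transitivity (r *: e ord0 - \sum_i c i *: e i); last by rewrite -rE subrr.
rewrite -[in RHS](sum_delta_scale e ord0) scaler_sumr -sumrB.
by apply: eq_bigr => i _; rewrite scalerBl scalerA.
Qed.

Lemma residue_unique z r t : residue z r -> residue z t -> r - t \in m.
Proof.
move=> hr ht; apply: scalar_in_maximal => y.
have := in_mulB (ht y) (hr y).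
by rewrite opprB addrC addrA subrK scalerBl.
Qed.

Lemma nonmultiple_exists : exists y : M, ~ multiple x y.
Proof. by exists (e ord0); apply: (nonmultiple_generator lp mine). Qed.

(** For phi a coordinate and s in the socle, the endomorphism y |-> phi(y) s of
    M / x M lifts to M, so it commutes with z: phi(y) z(s) = phi(z(y)) s modulo x M.
    Taking phi(y) = 1 shows that z(s) is a multiple r s with r independent of s;
    inserting this back gives phi(z(y)) = r phi(y) modulo m for every coordinate. *)
Lemma residue_exists z : exists r, residue z r /\
  forall s, in_socle s -> multiple x (zact z s - r *: s).
Proof.
have [phi phiP] := minimal_coordinates mine.
have comm i s y : in_socle s -> multiple x (phi y i *: zact z s - phi (zact z y) i *: s).
  move=> ss; have [|H HP] := lift (h := fun y => phi y i *: s).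
    move=> a u v; rewrite scalerA -scalerDl -scalerBl; exact/ss/(coordinates_linear phiP).
  have h1 : multiple x (zact z (H y) - phi y i *: zact z s).
    have [w hw] := HP y; exists (zact z w).
    by rewrite -!linearZ -linearB hw linearZ.
  have h2 := HP (zact z y); rewrite -zact_comm in h2.
  have := multipleB h2 h1; rewrite opprB addrC addrA subrK.
  exact.
have phi0 := coordinates_generator phiP ord0 ord0; rewrite eqxx in phi0.
pose r := phi (zact z (e ord0)) ord0.
have hs s : in_socle s -> multiple x (zact z s - r *: s).
  move=> ss; have h1 := comm ord0 _ (e ord0) ss; rewrite -/r in h1.
  have [w hw] := ss _ phi0.
  have h2 : multiple x ((phi (e ord0) ord0 - 1) *: zact z s).
    by exists (zact z w); rewrite -linearZZ hw linearZZ.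
  have := multipleB h1 h2; rewrite scalerBl scale1r.
  by rewrite opprB addrC addrA subrK.
exists r; split=> // y.
have [u nu] := nonmultiple_exists.
have [s [ns ss]] := socle_modulo_parameter lp nu.
have inm i : phi (zact z y) i - r * phi y i \in m.
  apply: contrapT => /negP /(local_unit lp) [v ve]; apply: ns.
  rewrite -[s]scale1r -ve -scalerA; apply: multipleZ.
  have := multipleB (multipleZ (phi y i) (hs s ss)) (comm i s y ss).
  by rewrite scalerBr opprB addrC addrA subrK scalerA mulrC -scalerBl.
rewrite (phiP.1 (zact z y)) {2}(phiP.1 y) scaler_sumr -sumrB.
by apply: in_mul_sum => i; rewrite scalerA -scalerBl; apply: in_mul_scale.
Qed.

Lemma residue_socle z r s : residue z r -> in_socle s -> multiple x (zact z s - r *: s).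
Proof.
move=> hr ss; have [t [ht hts]] := residue_exists z.
rewrite -[zact z s](subrK (t *: s)) -addrA; apply: multipleD; first exact: hts.
by rewrite -scalerBl; apply: ss; apply: residue_unique ht hr.
Qed.

Lemma zact_exp z (C : 'M[R]_n.+1) :
    (forall i, zact z (e i) = \sum_j C i j *: e j) ->
  forall k i, zact (z ^+ k) (e i) = \sum_j (C ^+ k) i j *: e j.
Proof.
move=> zC; elim=> [|k IHk] i.
  rewrite !expr0 zact1 (bigD1 i) //= mxE eqxx scale1r big1 ?addr0 // => j.
  by rewrite mxE eq_sym => /negPf ->; rewrite scale0r.
rewrite exprS zactM IHk linear_sum.
under eq_bigr => j _ do rewrite linearZZ zC scaler_sumr.
rewrite exchange_big; apply: eq_bigr => l _.
rewrite exprSr [in RHS]mxE scaler_suml; apply: eq_bigr => j _.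
by rewrite scalerA.
Qed.

(** The action of z on generators is given by a matrix with coefficients in m, whose
    characteristic polynomial is a power of X modulo m; conclude by Cayley-Hamilton. *)
Lemma residue0_nilpotent z : residue z 0 -> exists k, in_mul m (z ^+ k).
Proof.
move=> z0; have coefs i : exists c : 'I_n.+1 -> R,
    (forall j, c j \in m) /\ zact z (e i) = \sum_j c j *: e j.
  exact: in_mul_coef mine.1 (residue0_in_mul _ z0).
have [c cP] := choice coefs; pose C := \matrix_(i, j) c i j.
have zC i : zact z (e i) = \sum_j C i j *: e j.
  by have [_ ->] := cP i; apply: eq_bigr => j _; rewrite mxE.
pose p := char_poly C.
have hornerE : horner_mx C p = \sum_(k < size p) p`_k *: C ^+ k.
  rewrite -{1}[p]coefK poly_def rmorph_sum /=; apply: eq_bigr => k _.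
  by rewrite horner_mxZ rmorphXn /= horner_mx_X.
have pz : \sum_(k < size p) p`_k *: z ^+ k = 0.
  apply: zact_inj => y; have [d ->] := mine.1 y; rewrite linear_sum big1 // => i _.
  rewrite linearZZ zact_sum.
  under eq_bigr => k _ do rewrite zactZ (zact_exp zC) scaler_sumr.
  rewrite exchange_big big1 ?scaler0 // => j _.
  have h : \sum_(k < size p) p`_k * (C ^+ k) i j = 0.
    have := Cayley_Hamilton C; rewrite -/p hornerE => /matrixP /(_ i j).
    by rewrite summxE mxE; under eq_bigr => k _ do rewrite mxE.
  under eq_bigr => k _ do rewrite scalerA.
  by rewrite -scaler_suml h scale0r.
have pm k : (k < n.+1)%N -> p`_k \in m.
  pose pi : {rmorphism R -> {ideal_quot m}} := \pi_({ideal_quot m})%qT.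
  move=> kn; have pi0 a : a \in m -> pi a = 0.
    by move=> am; apply/eqP; rewrite -[0](rmorph0 pi) -Quotient.idealrBE subr0.
  have C0 : map_mx pi C = 0 by apply/matrixP => i j; rewrite !mxE pi0 //; case: (cP i).
  have : map_poly pi p = 'X^(n.+1).
    by rewrite map_char_poly C0 /char_poly /char_poly_mx map_mx0 subr0 det_scalar.
  move=> /polyP /(_ k); rewrite coef_map coefXn (ltn_eqF kn) => pk0.
  by rewrite -[p`_k]subr0 Quotient.idealrBE rmorph0; apply/eqP.
exists n.+1; move: pz; rewrite size_char_poly big_ord_recr /=.
have /monicP : p \is monic by exact: char_poly_monic.
rewrite lead_coefE size_char_poly => -> /eqP; rewrite scale1r addrC addr_eq0 => /eqP ->.
rewrite -scaleN1r; apply/in_mulZ/in_mul_sum => k; apply: in_mul_scale; exact: pm.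
Qed.

Lemma Zend_scalar_of_residue0 :
    finitely_generated (Zend M) -> (forall z, residue z 0 -> in_mul m z) ->
  forall z, exists r, z = homothety M r.
Proof.
move=> fgZ h; apply: (cyclic_modulo_maximal lp fgZ) => z.
have [r [zr _]] := residue_exists z; exists r.
exact/h/residueB_scalar.
Qed.
End Residue.

(** * Modules of positive rank *)

Section QuotientModule.
Variables (R : pzRingType) (A : lmodType R) (P : A -> Prop).
Hypothesis P0 : P 0.
Hypothesis PP : forall a u v, P u -> P v -> P (a *: u + v).

Lemma quotient_module_exists : exists (B : lmodType R) (p : {linear A -> B}),
  surjective p /\ forall u, p u = 0 <-> P u.
Proof.
have cl : zmod_closed (fun u => `[< P u >] : bool).
  split=> [|u v /asboolP Pu /asboolP Pv]; apply/asboolP => //.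
  by rewrite addrC -scaleN1r; apply: PP.
pose I : zmodClosed A := HB.pack (fun u => `[< P u >] : bool)
  (GRing.isZmodClosed.Build A _ cl).
pose B0 : zmodType := Quotient.quot I.
pose p0 : A -> B0 := \pi_(Quotient.quot I)%qT.
have p0K (b : B0) : p0 (repr b) = b by exact: reprK.
have p0E u v : p0 u = p0 v <-> u - v \in I.
  by rewrite Quotient.idealrBE; split=> [e|/eqP]; first exact/eqP.
have p0B u v : p0 (u - v) = p0 u - p0 v by rewrite /p0 raddfB.
have p0D u v : p0 (u + v) = p0 u + p0 v by rewrite /p0 raddfD.
pose sc a (b : B0) : B0 := p0 (a *: repr b).
have scE a u : sc a (p0 u) = p0 (a *: u).
  apply/p0E; rewrite -scalerBr.
  have /p0E /asboolP Ph := p0K (p0 u).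
  by apply/asboolP; rewrite -[_ *: _]addr0; apply: PP.
have scA a b v : sc a (sc b v) = sc (a * b) v.
  by rewrite -[v]p0K !scE scalerA.
have sc1 : left_id 1 sc by move=> v; rewrite -[v]p0K !scE scale1r.
have scDr : right_distributive sc +%R.
  by move=> a u v; rewrite -[u]p0K -[v]p0K -p0D !scE -p0D scalerDr.
have scDl v : {morph sc^~ v : a b / a + b}.
  by move=> a b; rewrite -[v]p0K !scE -p0D scalerDl.
pose B : lmodType R := HB.pack (Quotient.quot I) (GRing.Zmodule.on (Quotient.quot I))
  (GRing.Zmodule_isLmodule.Build R (Quotient.quot I) scA sc1 scDr scDl).
have pl : linear (p0 : A -> B).
  by move=> a u v; rewrite p0D; congr (_ + _); rewrite -scE.
pose p : {linear A -> B} := linear_of pl.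
have p00 : p0 0 = 0 by rewrite /p0 raddf0.
exists B, p; split=> [b|u]; first by exists (repr b); apply: p0K.
change (p0 u = 0 <-> P u).
by rewrite -p00 p0E subr0; split=> [/asboolP|h]; last exact/asboolP.
Qed.
End QuotientModule.

Local Notation restrict := Defs.restrict.

Section Rank.
Variables (R : comNzRingType) (M : lmodType R) (Q : comUnitRingType)
  (iota : {rmorphism R -> Q}) (T : lmodType Q)
  (t : {bilinear M -> restrict iota Q^o -> restrict iota T}).
Hypothesis iotaQ : total_quotient_ring iota.
Hypothesis tT : tensor_product t.

(** The projection from T to T / U and the zero map agree on pure tensors, hence they
    are equal by the uniqueness part of the universal property. *)
Lemma tensor_span (U : T -> Prop) :
    U 0 -> (forall a u v, U u -> U v -> U (iota a *: u + v)) ->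
    (forall y q, U (t y q)) -> forall u, U u.
Proof.
move=> U0 UP Ut u.
have [B [p [_ pP]]] := @quotient_module_exists R (restrict iota T) U U0 UP.
have z0 : bilinear_for *:%R *:%R (fun (_ : M) (_ : restrict iota Q^o) => 0 : B).
  by split=> y a v w /=; rewrite scaler0 addr0.
pose z : {bilinear M -> restrict iota Q^o -> B} := HB.pack (fun _ _ => 0 : B)
  (bilinear_isBilinear.Build R M (restrict iota Q^o) B *:%R *:%R _ z0).
have [f [_ fu]] := tT z.
have e1 : f = p by apply: fu => y q; apply/pP/Ut.
have e2 : f = hom_zero _ _ by apply: fu => y q.
by apply/pP; rewrite -e1 e2.
Qed.

Lemma tensor_fraction (u : T) : exists d y, GRing.lreg d /\ iota d *: u = t y 1.
Proof.
have [_ iotaU iotaF] := iotaQ.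
move: u; apply: tensor_span => [|a u v [d [y [rd ud]]] [d' [y' [rd' vd]]]|y q].
- exists 1, 0; split; first exact: GRing.lreg1.
  by rewrite scaler0 linear0l.
- exists (d * d'), ((a * d') *: y + d *: y'); split; first exact: GRing.lregM.
  rewrite linearDl !linearZl_LR /= scalerDr; congr (_ + _).
    change (iota (d * d') *: (iota a *: u) = iota (a * d') *: (t y 1 : T)).
    by rewrite -ud !scalerA -!rmorphM; congr (iota _ *: _); ring.
  change (iota (d * d') *: v = iota d *: (t y' 1 : T)).
  by rewrite -vd scalerA rmorphM.
have [a [s [rs ->]]] := iotaF q.
exists s, (a *: y); split => //; rewrite linearZl_LR -linearZr_LR.
change (iota s *: (t y (iota a / iota s) : T)) with (s *: t y (iota a / iota s)).
rewrite -linearZr_LR; congr (t y _); rewrite /GRing.scale /= /restrict_scale /GRing.scale /=.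
by rewrite mulr1 mulrCA divrr ?mulr1 // iotaU.
Qed.
End Rank.

(** Clear denominators in a coordinate of M (x) Q = Q^r, and in the preimage of the
    corresponding basis vector. *)
Lemma rank_functional (R : comNzRingType) (M : lmodType R) (r : nat) :
    has_rank M r -> (0 < r)%N -> finitely_generated M ->
  exists (c : {linear M -> R^o}) (y0 : M), GRing.lreg (c y0 : R).
Proof.
move=> [Q [iota [T [t [iotaQ tT tQ [phi [psi phiK psiK]]]]]]] r0 [n [g gP]].
have [iotaI iotaU iotaF] := iotaQ.
pose k (y : M) : Q := psi (t y 1) 0 (Ordinal r0).
have kP a u v : k (a *: u + v) = iota a * k u + k v.
  rewrite /k linearPl; set X := t u 1; set Y := t v 1.
  have -> : a *: X + Y = iota a *: (X : T) + Y by [].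
  have -> : psi (iota a *: (X : T) + Y) = iota a *: psi X + psi Y.
    by apply: (can_inj phiK); rewrite linearP !psiK.
  by rewrite !mxE.
have k0 : k 0 = 0.
  by have := kP (-1) 0 0; rewrite scaler0 addr0 rmorphN1 mulN1r addNr.
have [d [dr dk]] : exists d, GRing.lreg d /\ forall i, exists a, iota a = iota d * k (g i).
  have h i : exists s, GRing.lreg s /\ exists a, iota a = iota s * k (g i).
    have [a [s [rs ->]]] := iotaF (k (g i)); exists s; split=> //; exists a.
    by rewrite mulrCA divrr ?mulr1 // iotaU.
  have [s sP] := choice h; exists (\prod_i s i); split.
    elim/big_rec: _ => [|i y _ yr]; first exact: GRing.lreg1.
    by apply: GRing.lregM => //; case: (sP i).
  move=> i; have [_ [a ae]] := sP i; exists (a * \prod_(j | j != i) s j).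
  by rewrite rmorphM ae [in RHS](bigD1 i) //= [in RHS]rmorphM mulrAC.
have {}dk y : exists a, iota a = iota d * k y.
  have [c ->] := gP y; elim/big_rec: _ => [|i u _ [b be]].
    by exists 0; rewrite k0 mulr0 rmorph0.
  have [a ae] := dk i; exists (c i * a + b).
  by rewrite kP rmorphD rmorphM ae be mulrDr mulrCA.
have [c cP] := choice dk.
have cl : linear (c : M -> R^o).
  move=> a u v; apply: iotaI.
  change (iota (c (a *: u + v)) = iota (a * c u + c v)).
  by rewrite rmorphD rmorphM !cP kP mulrDr mulrCA.
pose cL : {linear M -> R^o} := linear_of cl.
have [d' [y0 [rd' ye]]] := tensor_fraction iotaQ tT (phi (delta_mx 0 (Ordinal r0))).
exists cL, y0 => a b /= e; apply: iotaI.
have ku : k y0 = iota d'.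
  rewrite /k -ye -linearZ phiK !mxE !eqxx mulr1 //.
have cu : iota (c y0) \is a GRing.unit by rewrite cP ku unitrM !iotaU.
by apply: (mulrI cu); rewrite -!rmorphM; congr (iota _).
Qed.

(** * Consequences of reflexivity *)

(** The trace ideal of A, generated by the values f(y), is not contained in the
    annihilator of s modulo x unless s / x is in S. Otherwise f |-> (s / x) f is an
    endomorphism of the dual; its transpose is an endomorphism g of the bidual,
    which is A, with x g = s. As g is central it is a homothety. *)
Lemma reflexive_trace (S : comPzRingType) (A : lmodType S) (x s : S) :
    reflexive_module A ->
    (forall g : {linear A -> A},
       (forall (h : {linear A -> A}) y, g (h y) = h (g y)) ->
       exists c, forall y, g y = c *: y) ->
    (forall c : S, (forall y : A, c *: y = 0) -> c = 0) ->
    GRing.lreg x ->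
    (forall (f : {linear A -> S^o}) (y : A), exists b, s * f y = x * b) ->
  exists c, s = x * c.
Proof.
move=> [ev_inv evK ev_invK] cent faithful xreg div.
have Sreg (b : S) : x * b = 0 -> b = 0 by move=> xb; apply: xreg; rewrite xb mulr0.
have divf (f : {linear A -> S^o}) :
    exists f' : {linear A -> S^o}, forall y, s * f y = x * f' y.
  have [f' f'P] := choice (div f).
  have lf : linear (f' : A -> S^o).
    move=> a u v; apply: xreg; rewrite -f'P linearP.
    change (s * (a * f u + f v) = x * (a * f' u + f' v)).
    by rewrite !mulrDr !(mulrCA _ a) !f'P.
  pose F : {linear A -> S^o} :=
    linear_of lf.
  by exists F.
have [th thP] := choice divf.
have evth y : linear (fun f : {linear A -> S^o} => th f y : S^o).
  move=> a f g; apply: xreg; rewrite -thP.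
  change (s * (a * f y + g y) = x * (a * th f y + th g y)).
  by rewrite !mulrDr !(mulrCA _ a) !thP.
have gex y : exists w, forall f : {linear A -> S^o}, f w = th f y.
  pose F : {linear {linear A -> S^o} -> S^o} :=
    linear_of (evth y).
  exists (ev_inv F) => f; have := ev_invK F.
  by move/(congr1 (fun G : {linear {linear A -> S^o} -> S^o} => G f)).
have sep (u v : A) : (forall f : {linear A -> S^o}, f u = f v) -> u = v.
  by move=> e; apply: (can_inj evK); apply: linear_eqP => f; apply: e.
have Areg (u : A) : x *: u = 0 -> u = 0.
  move=> xu; apply: sep => f; rewrite linear0; apply: Sreg.
  by have := linearZ_LR f x u; rewrite xu linear0.
have [g gP] := choice gex.
have xg y : x *: g y = s *: y.
  apply: sep => f; rewrite !linearZ_LR gP.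
  by have := thP f y.
have glin : linear g.
  move=> a u v; apply/eqP; rewrite -subr_eq0; apply/eqP/Areg.
  rewrite scalerBr scalerDr scalerA mulrC -scalerA !xg scalerDr !scalerA mulrC.
  by rewrite subrr.
pose gL : {linear A -> A} := linear_of glin.
have [h y|c cP] := cent gL.
  apply/eqP; rewrite -subr_eq0; apply/eqP/Areg.
  change (x *: (g (h y) - h (g y)) = 0).
  by rewrite scalerBr xg -(linearZ_LR h x) xg linearZ_LR subrr.
exists c; apply/eqP; rewrite -subr_eq0; apply/eqP/faithful => y.
by rewrite scalerBl -xg [g y]cP scalerA subrr.
Qed.

(** The complement of the image of R is realized as the quotient M / R y. *)
Lemma split_functional (R : comNzRingType) (M : lmodType R)
    (f : {linear M -> R^o}) (y : M) : f y = 1 -> direct_summand R^o M.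
Proof.
move=> fy.
have [||C [p [psurj pP]]] := @quotient_module_exists R M (fun u => exists r, u = r *: y).
- by exists 0; rewrite scale0r.
- by move=> a _ _ [r ->] [t ->]; exists (a * r + t); rewrite scalerDl scalerA.
pose F u : (R^o * C)%type := (f u, p u).
have Fl : linear F by move=> a u v; rewrite /F !linearP.
pose FL : {linear M -> (R^o * C)%type} := linear_of Fl.
have surj w : exists u, F u = w.
  case: w => r c; have [u pu] := psurj c.
  have py : p y = 0 by apply/pP; exists 1; rewrite scale1r.
  exists (u + (r - f u) *: y); rewrite /F !linearD !linearZ_LR fy py scaler0 addr0 pu.
  by congr (_, _); rewrite [_ *: _]mulr1 addrC subrK.
have inj : injective F.
  move=> u v [fuv puv]; apply/eqP; rewrite -subr_eq0; apply/eqP.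
  have [|r e] := (pP (u - v)).1; first by rewrite linearB puv subrr.
  have : f (u - v) = 0 by rewrite linearB fuv subrr.
  by rewrite e linearZ_LR fy [_ *: _]mulr1 => ->; rewrite scale0r.
have [G GK] := choice surj; exists C, FL; exists G => // u.
by apply: inj; rewrite GK.
Qed.

Lemma Zend_isomorphism (R : comNzRingType) (M : lmodType R) :
    (forall a : R, (forall y : M, a *: y = 0) -> a = 0) ->
    (forall z : Zend M, exists r, z = homothety M r) ->
  exists f : {linear Zend M -> R^o}, GRing.monoid_morphism f /\ bijective f.
Proof.
move=> faithful scal; have [f fP] := choice scal.
have homo_inj : injective (homothety M).
  move=> a b e; apply/eqP; rewrite -subr_eq0; apply/eqP/faithful => y.
  have := congr1 (fun z => zact z y) e; rewrite /homothety !zactZ zact1 => ab.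
  by rewrite scalerBl ab subrr.
have fl : linear (f : Zend M -> R^o).
  move=> a z w; apply: homo_inj; rewrite -fP {1}(fP z) {1}(fP w).
  by rewrite /homothety scalerA -scalerDl.
pose F : {linear Zend M -> R^o} := linear_of fl.
exists F; split; first split.
- by apply: homo_inj; rewrite -fP /homothety scale1r.
- move=> z w; apply: homo_inj; rewrite -fP {1}(fP z) {1}(fP w).
  by rewrite /homothety Zend_scalerAl mul1r scalerA.
by exists (homothety M) => [z|r]; [rewrite -fP|apply: homo_inj; rewrite -fP].
Qed.

(** * Modules isomorphic to an ideal *)

Lemma linear_divide (R : comPzRingType) (A B : lmodType R) (x : R) (f : {linear A -> B}) :
    (forall y : B, x *: y = 0 -> y = 0) -> (forall y, multiple x (f y)) ->
  exists g : {linear A -> B}, forall y, f y = x *: g y.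
Proof.
move=> xreg xf; have [g gP] := choice xf.
have gl : linear g.
  move=> a u v; apply/eqP; rewrite -subr_eq0; apply/eqP/xreg.
  by rewrite scalerBr scalerDr scalerA mulrC -scalerA -!gP linearP subrr.
by exists (linear_of gl).
Qed.

Section IdealEndomorphisms.
Variables (R : comNzRingType) (I : ideal R).
Local Notation N := (ideal_module I).
Implicit Types (f g : {linear N -> N}) (u v : N).

Lemma ideal_scaleC u v : (val u : R) *: v = (val v : R) *: u.
Proof. by apply: val_inj; apply: mulrC. Qed.

Lemma ideal_cancel (s : R) (Is : s \in I) : GRing.lreg s ->
  forall u, s *: u = 0 -> u = 0.
Proof.
move=> rs u su; apply: val_inj; apply: rs.
by rewrite [RHS]mulr0; apply: (congr1 val su).
Qed.

(** Endomorphisms of I are multiplications by fractions: s f(v) = v f(s), which is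
    used twice for a regular s in I. *)
Lemma ideal_endoC f g u : positive_grade I -> f (g u) = g (f u).
Proof.
move=> [s Is rs]; pose w : N := exist (fun r => r \in (I : {pred R^o})) s Is.
have sf (h : {linear N -> N}) v : s *: h v = (val v : R) *: h w.
  have -> : s *: h v = h ((val w : R) *: v) by rewrite linearZ_LR.
  by rewrite ideal_scaleC linearZ_LR.
have ss (h1 h2 : {linear N -> N}) :
    s *: (s *: h1 (h2 u)) = (val u : R) *: ((val (h2 w) : R) *: h1 w).
  rewrite sf; transitivity ((val (s *: h2 u) : R) *: h1 w); first by rewrite scalerA.
  by rewrite sf [RHS]scalerA.
apply/eqP; rewrite -subr_eq0; apply/eqP/(ideal_cancel Is rs)/(ideal_cancel Is rs).
by rewrite !scalerBr !ss (ideal_scaleC (g w)) subrr.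
Qed.
End IdealEndomorphisms.

Section IdealCase.
Variables (R : comNzRingType) (m : idealr R) (x : R) (I : ideal R).
Local Notation N := (ideal_module I).
Hypothesis lp : local_parameter m x.
Hypothesis Ipos : positive_grade I.
Hypothesis lift : forall h : N -> N, linear_modulo (multiple x) h ->
  exists H : {linear N -> N}, forall y, multiple x (H y - h y).
Hypothesis ext : Ext_vanishes 1 (end_module N) (End N)^o.
Variables (n : nat) (e : 'I_n.+1 -> N).
Hypothesis mine : minimal_generators m e.

Let xreg (u : N) : x *: u = 0 -> u = 0.
Proof.
move=> xu; apply: val_inj; apply: (parameter_reg lp).
by rewrite [RHS]mulr0; apply: (congr1 val xu).
Qed.

Let xE : End N := x *: (1 : End N).

Lemma End_multiple (f : End N) :
  (forall y, multiple x ((f : {linear N -> N}) y)) -> multiple (xE : End N) (f : (End N)^o).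
Proof.
move=> xf; have [g gP] := linear_divide xreg xf.
by exists (g : End N); apply: linear_eqP.
Qed.

(** The value H(u)(v) is q u v for a fraction q depending on H only. To avoid
    fractions, observe that w H(u)(v) = H(v u)(w) for w in I, and take w regular. *)
Lemma ideal_pairing_symmetric (H : {linear end_module N -> (End N)^o}) (u v : N) :
  (H u : {linear N -> N}) v = (H v : {linear N -> N}) u.
Proof.
have [s Is rs] := Ipos; pose w : N := exist (fun r => r \in (I : {pred R^o})) s Is.
pose K (a : N) : {linear N -> N} := H a.
have KZ (r : R) a : K (r *: a) = r *: K a.
  have h : K (r *: a) = (r *: (1 : End N)) * (K a : End N) :=
    linearZ_LR H (r *: (1 : End N)) a.
  by rewrite h; apply: linear_eqP.
have sw (a b : N) : (val w : R) *: K a b = K ((val b : R) *: a) w.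
  have -> : (val w : R) *: K a b = K a ((val w : R) *: b) by rewrite linearZ_LR.
  by rewrite ideal_scaleC linearZ_LR KZ.
apply/eqP; rewrite -subr_eq0; apply/eqP/(ideal_cancel Is rs); rewrite scalerBr.
change ((val w : R) *: K u v - (val w : R) *: K v u = 0).
by rewrite !sw (ideal_scaleC v u) subrr.
Qed.

(** For two distinct minimal generators, the maps b |-> phi_i(a) phi_j(b) s lift to
    endomorphisms rho(a) of I, and a |-> rho(a) is linear over End(I) modulo x, so
    it lifts to some H : I -> End(I). By symmetry, s = H(e_i)(e_j) = H(e_j)(e_i) = 0
    modulo x I, contrary to the choice of s. *)
Lemma ideal_case_cyclic : n = 0.
Proof.
case: n e mine => // k g ming; exfalso.
have [phi phiP] := minimal_coordinates ming.
have [|s [ns ss]] := @socle_modulo_parameter _ _ _ lp _ (g ord0).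
  exact: (nonmultiple_generator lp ming).
pose i : 'I_k.+2 := ord0; pose j : 'I_k.+2 := fintype.lift ord0 ord0.
have hlin c l : linear_modulo (multiple x) (fun y => (c * phi y l) *: s).
  move=> a u v; rewrite scalerA -scalerDl -scalerBl.
  rewrite (_ : _ - _ = c * (phi (a *: u + v) l - (a * phi u l + phi v l))); last by ring.
  by apply/ss/idealMr/(coordinates_linear phiP).
have [rho rhoP] := choice (fun a => lift (hlin (phi a i) j)).
have [||||H HP] := @lift_linear_modulo (End N) (end_module N) (End N)^o xE
    (fun a => rho a : End N).
- by move=> f; apply: linear_eqP => y; apply: (linearZ_LR (f : {linear N -> N})).
- move=> f xf; apply: linear_eqP => y; apply: xreg.
  exact: (congr1 (fun h : {linear N -> N} => h y) xf).
- exact: (Ext_vanishes_extends (n := 0)).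
- move=> f u v; apply: End_multiple => b.
  have cf : exists z : Zend N, forall y, zact z y = (f : {linear N -> N}) y.
    by apply: central_endomorphism => h y; apply: ideal_endoC.
  have [z zf] := cf; have [r [zr zs]] := residue_exists lp ming lift z.
  set fu := (f : {linear N -> N}) u.
  have -> : (rho (f *: u + v) - (f *: (rho u : (End N)^o) + rho v) : {linear N -> N}) b =
    rho (fu + v) b - ((f : {linear N -> N}) (rho u b) + rho v b) by [].
  rewrite -zf; have [w hw] := rhoP u b.
  apply: multiple_trans (rhoP (fu + v) b) _.
  (* phi (f u + v) s = phi (f u) s + phi v s, and phi (f u) s = r phi u s = phi u f s *)
  apply: (multiple_trans (v := (phi fu i * phi b j) *: s + (phi v i * phi b j) *: s)).
    rewrite -scalerDl -scalerBl; apply: ss.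
    rewrite (_ : _ - _ = phi b j * (phi (fu + v) i - (1 * phi fu i + phi v i))); last by ring.
    by apply: idealMr; have := coordinates_linear phiP i 1 fu v; rewrite scale1r.
  apply: multiple_add; last exact: multiple_sym.
  apply: (multiple_trans (v := (phi u i * phi b j * r) *: s)).
    rewrite -scalerBl; apply: ss.
    rewrite (_ : _ - _ = phi b j * (phi fu i - r * phi u i)); last by ring.
    by apply: idealMr; rewrite /fu -zf; apply: (coordinates_scale phiP).
  apply: (multiple_trans (v := (phi u i * phi b j) *: zact z s)).
    by rewrite -scalerA -scalerBr; apply/multipleZ/multiple_sym/zs.
  by apply: multiple_sym; exists (zact z w); rewrite -!linearZ_LR -linearB hw linearZ_LR.
have hH a b : multiple x ((H a : {linear N -> N}) b - (phi a i * phi b j) *: s).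
  apply: multiple_trans (rhoP a b).
  have [w hw] := HP a; exists ((w : {linear N -> N}) b).
  exact: (congr1 (fun h : {linear N -> N} => h b) hw).
have coef c d : c - d \in m -> multiple x (c *: s - d *: s).
  by move=> cd; rewrite -scalerBl; apply: ss.
have gen a b c : phi (g a) i - c \in m -> phi (g b) j - c \in m ->
    multiple x ((H (g a) : {linear N -> N}) (g b) - (c * c) *: s).
  move=> ac bc; apply: multiple_trans (hH _ _) _; apply: coef.
  have -> : phi (g a) i * phi (g b) j - c * c =
      phi (g b) j * (phi (g a) i - c) + c * (phi (g b) j - c) by ring.
  by rewrite rpredD ?idealMr.
have h1 := gen i j 1 (coordinates_generator phiP i i) (coordinates_generator phiP j j).
have h2 := gen j i 0 (coordinates_generator phiP i j) (coordinates_generator phiP j i).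
apply: ns; rewrite (ideal_pairing_symmetric H) in h1.
by have := multiple_trans (multiple_sym h1) h2; rewrite mulr1 mulr0 scale1r scale0r subr0.
Qed.
End IdealCase.

(** * A derivation of the center at its residue character *)

Section ResidueDerivation.
Variables (R : comNzRingType) (M : lmodType R) (m : idealr R) (x : R).
Hypothesis lp : local_parameter m x.
Variables (n : nat) (e : 'I_n.+1 -> M).
Hypothesis mine : minimal_generators m e.
Hypothesis lift : forall h : M -> M, linear_modulo (multiple x) h ->
  exists H : {linear M -> M}, forall y, multiple x (H y - h y).
Hypothesis fgZ : finitely_generated (Zend M).
Implicit Types (z w : Zend M).

Local Notation k := {ideal_quot m}.
Definition residue_map : {rmorphism R -> k} := \pi_(k)%qT.
Local Notation pi := residue_map.

Lemma residue_map_eq (a b : R) : pi a = pi b <-> a - b \in m.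
Proof. by rewrite Quotient.idealrBE; split=> [h|/eqP]; [apply/eqP|]. Qed.

Lemma residue_map_eq0 (a : R) : pi a = 0 <-> a \in m.
Proof. by rewrite -(rmorph0 pi) residue_map_eq subr0. Qed.

Definition residue_linear (l : Zend M -> k) :=
  forall a z w, l (a *: z + w) = pi a * l z + l w.

Lemma residue_linear0 l : residue_linear l -> l 0 = 0.
Proof.
by move=> ll; have := ll (-1) 0 0; rewrite scaler0 addr0 rmorphN1 mulN1r addNr.
Qed.

Lemma residue_linear_in_mul l z : residue_linear l -> in_mul m z -> l z = 0.
Proof.
move=> ll; elim=> [|a u v am _ IH]; first exact: residue_linear0.
by rewrite ll IH (residue_map_eq0 a).2 // mul0r addr0.
Qed.

Lemma residue_linear_sum l (I : Type) (s : seq I) (a : I -> R) (F : I -> Zend M) :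
  residue_linear l -> l (\sum_(i <- s) a i *: F i) = \sum_(i <- s) pi (a i) * l (F i).
Proof.
move=> ll; elim: s => [|i s IHs]; first by rewrite !big_nil residue_linear0.
by rewrite !big_cons ll IHs.
Qed.

(** The kernel n of the residue character acts on the functionals on Z / m Z through
    nilpotent operators. By common_socle, among the functionals that do not vanish
    on n there is one whose multiples by elements of n all vanish on n. *)
Lemma square_zero_functional (nu0 : Zend M) : residue m nu0 0 -> ~ in_mul m nu0 ->
  exists l : Zend M -> k, [/\ residue_linear l,
    exists2 nu : Zend M, residue m nu 0 & l nu <> 0
    & forall z w : Zend M, residue m z 0 -> residue m w 0 -> l (z * w) = 0].
Proof.
move=> nu00 nmul.
have [q [g ming]] := minimal_generators_exist lp fgZ.
have [psi psiP] := minimal_coordinates ming.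
have [i0 npsi] : exists i, psi nu0 i \notin m.
  apply: contrapT => nex; apply: nmul; rewrite (psiP.1 nu0).
  apply: in_mul_sum => i; apply: in_mul_scale; apply: contrapT => /negP h.
  by apply: nex; exists i.
have [r rP] := choice (fun i => residue_exists lp mine lift (g i)).
pose nu i := g i - homothety M (r i).
have nu_res i : residue m (nu i) 0 by apply: residueB_scalar; case: (rP i).
pose op i (l : Zend M -> k) := fun z => l (nu i * z).
have iterop i j (l : Zend M -> k) z : iter j (op i) l z = l (nu i ^+ j * z).
  elim: j z => [|j IHj] z; first by rewrite mul1r.
  by rewrite iterS /op IHj exprSr mulrA.
pose l0 z := pi (psi z i0).
have l0lin : residue_linear l0.
  move=> a z w; rewrite /l0 -rmorphM -rmorphD; apply/residue_map_eq.
  exact: (coordinates_linear psiP).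
have [| | | | |l [ll lz lop]] := @common_socle (Zend M -> k)
    (fun l => forall z : Zend M, residue m z 0 -> l z = 0)
    residue_linear q op _ _ _ _ l0 l0lin.
- by move=> i j l; apply/funext => z; rewrite /op mulrCA.
- by move=> i l lz z z0; apply/lz/residue0M.
- by move=> i l ll a z w; rewrite /op mulrDr Zend_scalerAr ll.
- move=> i l ll; have [j nuj] := residue0_nilpotent mine (nu_res i).
  exists j => z _; rewrite iterop; apply: residue_linear_in_mul => //.
  apply: (in_mul_image (f := fun w => w * z)) => // a u v.
  by rewrite mulrDl Zend_scalerAl.
- move=> /(_ _ nu00); rewrite /l0 residue_map_eq0; exact/negP.
exists l; split=> //.
  apply: contrapT => nex; apply: lz => z z0; apply: contrapT => lz0.
  by apply: nex; exists z.
move=> z w z0 w0.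
pose a i := psi z i; pose b := \sum_i a i * r i.
have zE : z = \sum_i a i *: nu i + homothety M b.
  rewrite {1}(psiP.1 z) /nu /homothety /b scaler_suml -big_split /=.
  by apply: eq_bigr => i _; rewrite scalerBr scalerA subrK.
have bm : b \in m.
  have zb : residue m z b.
    have -> : b = 0 + b by rewrite add0r.
    rewrite zE; apply: residueD; last exact: residue_scalar.
    elim/big_rec: _ => [y|i u _ ui].
      by rewrite scale0r subr0 zact0; constructor.
    rewrite -[0]addr0; apply: residueD => //.
    by rewrite -(mulr0 (a i)); apply: residueZ.
  by rewrite -[b]subr0; apply: (residue_unique mine zb z0).
have -> : z * w = \sum_i a i *: (nu i * w) + b *: w.
  rewrite {1}zE mulrDl mulr_suml; congr (_ + _).
    by apply: eq_bigr => i _; rewrite Zend_scalerAl.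
  by rewrite /homothety Zend_scalerAl mul1r.
rewrite addrC ll (residue_map_eq0 b).2 // mul0r add0r residue_linear_sum //.
by rewrite big1 // => i _; rewrite [l _](lop i) // mulr0.
Qed.

(** This characterizes the residue character of Z, as a map to R / m. *)
Definition residue_class (rho : Zend M -> k) :=
  forall z, exists2 r, residue m z r & rho z = pi r.

Lemma residue_classE (rho : Zend M -> k) z r :
  residue_class rho -> residue m z r -> rho z = pi r.
Proof.
move=> rhoP zr; have [t zt ->] := rhoP z; apply/residue_map_eq.
exact: (residue_unique mine zt zr).
Qed.

(** With Z = R + n, a functional l that kills n^2 but not n defines a derivation
    d(r + nu) = l(nu), which is R-linear and zero on R. *)
Lemma residue_derivation (nu0 : Zend M) : residue m nu0 0 -> ~ in_mul m nu0 ->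
  exists (rho d : Zend M -> k), [/\ residue_class rho, residue_linear d,
    forall z w, d (z * w) = rho z * d w + rho w * d z,
    forall a, d (homothety M a) = 0 & exists z, d z <> 0].
Proof.
move=> nu00 nmul; have [l [ll [nu nu_res lnu] lsq]] := square_zero_functional nu00 nmul.
have [r rP] := choice (residue_exists lp mine lift).
have zr z : residue m z (r z) by case: (rP z).
pose rho z := pi (r z); pose d z := l (z - homothety M (r z)).
have rhoP : residue_class rho by move=> z; exists (r z).
have dE z : d z = l z - rho z * l 1.
  by rewrite /d /homothety addrC -scaleNr ll rmorphN mulNr addrC.
have rhoE z t : residue m z t -> rho z = pi t by exact: residue_classE.
have rhoM z w : rho (z * w) = rho z * rho w.
  by rewrite (rhoE _ _ (residueM (zr z) (zr w))) rmorphM.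
have rhoL a z w : rho (a *: z + w) = pi a * rho z + rho w.
  by rewrite (rhoE _ _ (residueD (residueZ a (zr z)) (zr w))) rmorphD rmorphM.
have rho_homothety a : rho (homothety M a) = pi a.
  exact/rhoE/residue_scalar.
exists rho, d; split=> //.
- by move=> a z w; rewrite !dE ll rhoL; ring.
- move=> z w; have := lsq _ _ (residueB_scalar (zr z)) (residueB_scalar (zr w)).
  have hs a (y : Zend M) : a *: y = homothety M a * y.
    by rewrite /homothety Zend_scalerAl mul1r.
  have -> : (z - homothety M (r z)) * (w - homothety M (r w)) =
     (- r z) *: w + ((- r w) *: z + ((r z * r w) *: (1 : Zend M) + z * w : Zend M)).
    by rewrite !scaleNr -scalerA !hs; ring.
  rewrite !ll !rmorphN rmorphM -!/(rho _) !dE rhoM => h.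
  apply/eqP; rewrite -subr_eq0 -h; apply/eqP; ring.
- move=> a; rewrite dE rho_homothety /homothety -[_ *: _]addr0 ll.
  by rewrite residue_linear0 // addr0 subrr.
exists nu; rewrite dE (rhoE _ _ nu_res) rmorph0 mul0r subr0; exact: lnu.
Qed.
End ResidueDerivation.

(** * Vanishing of the second Ext over the center *)

Section FreeModuleExtensionality.
Variables (S : pzRingType) (X : choiceType).
Implicit Types (u v : free_module S X).

Lemma free_eq u v : (forall y, coef u y = coef v y) -> u = v.
Proof. by move=> uv; apply/val_inj/funext. Qed.

Lemma coefD a u v y : coef (a *: u + v) y = a * coef u y + coef v y.
Proof. by []. Qed.

Lemma free_of_fun (f : X -> S) (s : seq X) : (forall y, y \notin s -> f y = 0) ->
  exists v, forall y, coef v y = f y.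
Proof.
move=> fs; have fin : (f : X -> S^o) \in @finite_support S X.
  by apply/finite_supportP; exists s.
by exists (exist (fun w => w \in @finite_support S X) (f : X -> S^o) fin).
Qed.

Lemma coef_notin v y : y \notin free_support v -> coef v y = 0.
Proof. by case: (Defs.supportP v) => _; apply. Qed.

Lemma sum_covers (V : nmodType) (F : X -> S -> V) v (s t : seq X) :
    (forall y, F y 0 = 0) -> covers s v -> covers t v ->
  \sum_(y <- s) F y (coef v y) = \sum_(y <- t) F y (coef v y).
Proof.
move=> F0 cs ct.
have aux r : \sum_(y <- r) F y (coef v y) =
    \sum_(y <- [seq y <- r | coef v y != 0]) F y (coef v y).
  rewrite big_filter [RHS]big_mkcond; apply: eq_bigr => y _.
  by case: eqP => //= ->.
rewrite aux [RHS]aux; apply: perm_big; apply: uniq_perm.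
- by apply: filter_uniq; case: cs.
- by apply: filter_uniq; case: ct.
move=> y; rewrite !mem_filter; case: eqP => //= vy.
by apply/idP/idP => _; apply: contrapT => /negP; [case: ct|case: cs] => _ h /h.
Qed.

Lemma common_cover u v :
  exists s, [/\ covers s u, covers s v & forall a, covers s (a *: u + v)].
Proof.
exists (undup (free_support u ++ free_support v)).
have h y : y \notin undup (free_support u ++ free_support v) -> coef u y = 0 /\ coef v y = 0.
  by rewrite mem_undup mem_cat negb_or => /andP [/coef_notin uy /coef_notin vy].
split=> [||a]; split; rewrite ?undup_uniq // => y /h [uy vy] //.
by rewrite coefD uy vy mulr0 addr0.
Qed.
End FreeModuleExtensionality.

Section SecondExt.
Variables (R : comNzRingType) (M : lmodType R) (m : idealr R) (x : R).
Hypothesis lp : local_parameter m x.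
Hypothesis M_tf : torsion_free M.
Hypothesis faithful : forall a : R, (forall y : M, a *: y = 0) -> a = 0.
Variables (n : nat) (e : 'I_n.+1 -> M).
Hypothesis mine : minimal_generators m e.
Hypothesis ext1 : extends_from_syzygy M M.
Hypothesis ext2 :
  extends_from_syzygy (syzygy (zend_module M)) (zend_module M) .
Variables (D : R) (denom : Zend M -> R).
Hypothesis D_reg : GRing.lreg D.
Hypothesis denomP : forall z u, D *: zact z u = denom z *: u.
Hypothesis fgZ : finitely_generated (Zend M).

Local Notation S := (Zend M).
Local Notation A := (zend_module M).
Local Notation pi := (residue_map m).

Let xreg (u : M) : x *: u = 0 -> u = 0.
Proof. exact/M_tf/(parameter_reg lp). Qed.

Let lift (h : M -> M) : linear_modulo (multiple x) h ->
  exists H : {linear M -> M}, forall y, multiple x (H y - h y).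
Proof. by apply: lift_linear_modulo => // a; apply: mulrC. Qed.

(** Let d be the derivation and c(l) = sum_y d(l_y) phi(y) for l in the free module on
    M over Z. On the syzygy L, that is for l with sum_y l_y y = 0, the map
    l |-> c(l) s is Z-linear modulo x M, since
      c(a l) = rho(a) c(l) + d(a) phi(sum_y l_y y)
    and a acts on s by rho(a). Let H : L -> M be a lift. If l has coefficients in R
    then c(l) = 0, so H is divisible by x on the syzygy of M over R, and H / x
    extends to a map g on the free module over R. Since D Z is contained in R, one
    gets D H(l) = x g(D l) and so H(l) is in x M for all l in L. Hence c(l) s is in
    x M, that is c(l) = 0; but c takes the value d(z0) at z0 [y] - [z0 y] when
    phi(y) = 1. *)
Lemma residue0_in_mul_Zend (nu0 : S) : residue m nu0 0 -> in_mul m nu0.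
Proof.
move=> nu00; apply: contrapT => nmul.
have [rho [d [rhoP dlin dM dh [z0 dz0]]]] := residue_derivation lp mine lift fgZ nu00 nmul.
have [phi phiP] := minimal_coordinates mine.
have [s [ns ss]] := socle_modulo_parameter lp (nonmultiple_generator (i := ord0) lp mine).
have d0 : d 0 = 0 by exact: residue_linear0.
have dD z w : d (z + w) = d z + d w.
  by have := dlin 1 z w; rewrite scale1r rmorph1 mul1r.
pose p (y : M) := pi (phi y ord0).
have p_lin a u v : p (a *: u + v) = pi a * p u + p v.
  rewrite /p -rmorphM -rmorphD; apply/residue_map_eq; exact: (coordinates_linear phiP).
have pz z y : p (zact z y) = rho z * p y.
  have [r zr ->] := rhoP z; rewrite /p -rmorphM; apply/residue_map_eq.
  exact: (coordinates_scale phiP).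
have p0 : p 0 = 0 by have := p_lin (-1) 0 0; rewrite scaler0 addr0 rmorphN1 mulN1r addNr.
have p_sum (t : seq M) (F : M -> M) : p (\sum_(y <- t) F y) = \sum_(y <- t) p (F y).
  elim: t => [|y t IHt]; first by rewrite !big_nil.
  by rewrite !big_cons -IHt -[F y]scale1r p_lin rmorph1 mul1r scale1r.
(* the formula for c on a combination of u and v has a defect, which vanishes when u
   is a relation *)
pose c (l : free_module S A) := \sum_(y <- free_support l) d (coef l y) * p y.
have cE l t : covers t l -> c l = \sum_(y <- t) d (coef l y) * p y.
  move=> tl; apply: (sum_covers (F := fun y a => d a * p y)) => //.
    by move=> y; rewrite d0 mul0r.
  exact: Defs.supportP.
have c_lin a u v : c (a *: u + v) =
    rho a * c u + c v + d a * p (free_cover A u).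
  have [t [tu tv tuv]] := common_cover u v.
  rewrite !(cE _ t) //= (free_liftE _ tu) p_sum !mulr_sumr -!big_split /=.
  apply: eq_bigr => y _; rewrite coefD dD dM.
  change (p (coef u y *: (y : A))) with (p (zact (coef u y) y)).
  by rewrite pz; ring.
have cdirac y : c (dirac S y) = 0.
  by rewrite (cE _ _ (dirac_covers S y)) big_seq1 coef_dirac eqxx -[1]scale1r dh mul0r.
pose h (l : syzygy A) : A := repr (c (val l)) *: s.
have h_eq (a b : R) : pi a = pi b -> multiple x (a *: s - b *: s).
  by move=> /residue_map_eq ab; rewrite -scalerBl; apply: ss.
have pi_repr (b : {ideal_quot m}) : pi (repr b) = b by exact: reprK.
pose xS : S := homothety M x.
have multS (u : A) : multiple xS u <-> multiple x (u : M) by [].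
have [||||H HP] := @lift_linear_modulo S (syzygy A) A xS h.
- by move=> a; apply: mulrC.
- by move=> u; apply: xreg.
- exact: ext2.
- move=> a u v; apply/multS; rewrite /h.
  have -> : val (a *: u + v) = a *: val u + val v by [].
  have /eqP u0 := valP u; rewrite c_lin [free_cover A _]u0 p0 mulr0 addr0.
  have [r ar ->] := rhoP a; set b := c (val u); set b' := c (val v).
  change (multiple x (repr (pi r * b + b') *: s -
    (zact a (repr b *: s) + repr b' *: s))).
  apply: (multiple_trans (v := (repr b * r + repr b') *: s)).
    by apply: h_eq; rewrite pi_repr rmorphD rmorphM !pi_repr mulrC.
  rewrite scalerDl linearZ_LR -scalerA; apply: multiple_add.
    rewrite -scalerBr; apply/multipleZ/multiple_sym.
    exact: (residue_socle lp mine lift).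
  by rewrite subrr; apply: multiple0.
have kerL w : free_cover A w = 0 -> exists l : syzygy A, val l = w.
  by move=> /eqP w0; exists (exist (fun w => w \in @kernel_pred S A) w w0).
(* T is the inclusion of the syzygy of M over R in the syzygy over Z *)
have Tex (v : syzygy M) : exists l : syzygy A,
    forall y, coef (val l) y = homothety M (coef (val v) y).
  have [|w wE] := @free_of_fun S A (fun y => homothety M (coef (val v) y))
      (free_support (val v)).
    by move=> y /coef_notin ->; rewrite /homothety scale0r.
  have wv : covers (free_support (val v)) w.
    split; first by case: (Defs.supportP (val v)).
    by move=> y /coef_notin vy; rewrite wE vy /homothety scale0r.
  have [|l lw] := kerL w; last by exists l => y; rewrite lw.
  have /eqP <- := valP v; rewrite /= (free_liftE _ wv); apply: eq_bigr => y _.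
  by rewrite wE.
have [T TE] := choice Tex.
have kex v : exists w, H (T v) = x *: w.
  have hT : multiple x (h (T v) : M).
    rewrite /h (_ : c _ = 0); last first.
      by rewrite /c big1 // => y _; rewrite TE dh mul0r.
    by apply: ss; apply/residue_map_eq0; rewrite pi_repr.
  have := multipleD ((multS _).1 (HP (T v))) hT.
  by change (multiple x (H (T v) - h (T v) + h (T v)) -> multiple x (H (T v))); rewrite subrK.
have [k kP] := choice kex.
have klin : linear k.
  move=> a u v; apply/eqP; rewrite -subr_eq0; apply/eqP/xreg.
  rewrite scalerBr scalerDr scalerA mulrC -scalerA -!kP.
  have -> : T (a *: u + v) = homothety M a *: T u + T v.
    apply/val_inj/free_eq => y; rewrite TE [RHS]coefD !TE.
    by rewrite [X in homothety M X]coefD /homothety scalerDl Zend_scalerAl mul1r scalerA.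
  by rewrite linearP subrr.
pose kL : {linear syzygy M -> M} := linear_of klin.
have [g gP] := ext1 kL.
(* D l has coefficients in R *)
have Hx l : multiple x (H l).
  have denom0 : denom 0 = 0 by apply: faithful => u; rewrite -denomP zact0 scaler0.
  have [|v vE] := @free_of_fun R M (fun y => denom (coef (val l) y)) (free_support (val l)).
    by move=> y /coef_notin ->.
  have lv : covers (free_support (val l)) v.
    split; first by case: (Defs.supportP (val l)).
    by move=> y /coef_notin ly; rewrite vE ly.
  have v0 : free_cover M v = 0.
    have /eqP l0 := valP l.
    transitivity (D *: (free_cover A (val l) : M)); last by rewrite [free_cover A _]l0 scaler0.
    rewrite /= (free_liftE _ lv) /free_lift scaler_sumr; apply: eq_bigr => y _.
    by rewrite vE -denomP.
  pose v' : syzygy M := exist (fun w => w \in @kernel_pred R M) v (introT eqP v0).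
  have TD : T v' = homothety M D *: l.
    apply/val_inj/free_eq => y; rewrite TE -[_ *: l]addr0 [RHS]coefD.
    rewrite [coef (val 0) y](_ : _ = 0) // addr0 -[coef (val v') y]/(coef v y) vE.
    by apply: zact_inj => u; rewrite /homothety Zend_scalerAl mul1r !zactZ zact1 denomP.
  have := kP v'; rewrite TD [k v']gP /= linearZ_LR.
  change (D *: (H l : M) = x *: g v -> multiple x (H l)).
  rewrite {1}(free_decomp v) linear_sum.
  have -> : \sum_(y <- free_support v) g (coef v y *: dirac R y) =
      D *: \sum_(y <- free_support v) zact (coef (val l) y) (g (dirac R y)).
    by rewrite scaler_sumr; apply: eq_bigr => y _; rewrite linearZ_LR vE denomP.
  rewrite scalerA mulrC -scalerA => /eqP.
  rewrite -subr_eq0 -scalerBr => /eqP /(M_tf D_reg) /eqP.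
  by rewrite subr_eq0 => /eqP ->; eexists.
(* c is nonzero at the relation z0 [e0] - [z0 e0] *)
pose w0 := z0 *: dirac S (e ord0 : A) + (-1) *: dirac S (zact z0 (e ord0) : A).
have cover0 (y : A) : free_cover A (dirac S y) = y by apply: free_lift_dirac.
have [|l lw] := kerL w0.
  by rewrite /w0 linearD !linearZ_LR /= !free_lift_dirac scaleN1r subrr.
have cw0 : c w0 = d z0.
  have -> : w0 = z0 *: dirac S (e ord0 : A) +
      ((-1) *: dirac S (zact z0 (e ord0) : A) + 0) by rewrite addr0.
  have c0 : c 0 = 0 by rewrite (cE 0 [::]) ?big_nil //.
  rewrite c_lin c_lin !cdirac !cover0 c0.
  have -> : d (-1) = 0 by rewrite -[-1]scaleN1r dh.
  have -> : p (e ord0) = 1.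
    by rewrite -(rmorph1 pi); apply/residue_map_eq/(coordinates_generator phiP ord0 ord0).
  by rewrite !mulr0 mul0r !add0r mulr1.
have : multiple x (h l).
  by have := multipleB (Hx l) (HP l); rewrite opprB addrC subrK.
rewrite /h lw cw0 => hs.
have : repr (d z0) \notin m by apply/negP => /residue_map_eq0; rewrite pi_repr.
move=> /(local_unit lp) [v ve]; apply: ns.
by rewrite -[s]scale1r -ve -scalerA; apply: multipleZ.
Qed.
End SecondExt.

(** * Reflexivity over the center *)

Section ReflexiveCase.
Variables (R : comNzRingType) (M : lmodType R) (m : idealr R) (x : R).
Hypothesis lp : local_parameter m x.
Hypothesis M_tf : torsion_free M.
Variables (n : nat) (e : 'I_n.+1 -> M).
Hypothesis mine : minimal_generators m e.
Hypothesis lift : forall h : M -> M, linear_modulo (multiple x) h ->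
  exists H : {linear M -> M}, forall y, multiple x (H y - h y).

Let xreg (u : M) : x *: u = 0 -> u = 0.
Proof. exact/M_tf/(parameter_reg lp). Qed.

Lemma Zend_multiple (z : Zend M) :
  (forall y, multiple x (zact z y)) -> multiple x z.
Proof.
move=> xz; have [g gP] := linear_divide xreg xz.
have [H y|w wP] := @central_endomorphism _ M g.
  apply/eqP; rewrite -subr_eq0; apply/eqP/xreg.
  by rewrite scalerBr -(linearZ_LR H x) -!gP zact_comm subrr.
by exists w; apply: zact_inj => y; rewrite zactZ wP gP.
Qed.

(** Choose s in the socle of Z / x Z and, by reflexive_trace, a value w = f(y) of a
    functional with w s not in x Z; then w = r + nu with r a unit of R and nu in n.
    For z in n, z w = f(z y) is in m Z, because z y is in m M. Thus z and z nu agree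
    up to a unit modulo m Z, and nu is nilpotent modulo m Z. *)
Lemma reflexive_residue0_in_mul (z : Zend M) :
    reflexive_module (zend_module M) -> residue m z 0 -> in_mul m z.
Proof.
move=> refl.
have n1 : ~ multiple x (1 : Zend M).
  move=> [w w1]; apply: (nonmultiple_generator (i := ord0) lp mine).
  by exists (zact w (e ord0)); rewrite -zactZ -w1 zact1.
have [s [ns ss]] := socle_modulo_parameter lp n1.
have act_s (w : Zend M) r : residue m w r -> multiple x (w * s - r *: s).
  move=> wr; apply: Zend_multiple => y.
  apply: (residue_socle lp mine lift wr (s := zact s y)) => a /ss [t ts].
  by exists (zact t y); rewrite -!zactZ ts.
pose xZ := homothety M x.
have xZE w : xZ * w = x *: w by rewrite /xZ /homothety Zend_scalerAl mul1r.
have [f [y nfy]] : exists (f : {linear zend_module M -> (Zend M)^o}) y,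
    ~ exists b, s * f y = xZ * b.
  apply: contrapT => nex; apply: ns.
  have [|||f y|c ->] := @reflexive_trace (Zend M) (zend_module M) xZ s refl.
  - move=> g gC; pose G : M -> M := g.
    have Glin : linear G.
      by move=> a u v; apply: (linearP g (homothety M a) (u : zend_module M) v).
    pose GL : {linear M -> M} := linear_of Glin.
    have [H u|w wP] := @central_endomorphism _ M GL; last first.
      by exists w => u; rewrite -[LHS]wP.
    have Hlin : linear (H : zend_module M -> zend_module M).
      move=> a u' v; change (H (zact a u' + v) = zact a (H u') + H v).
      by rewrite linearD zact_comm.
    pose HL : {linear zend_module M -> zend_module M} :=
      linear_of Hlin.
    exact: (gC HL u).
  - by move=> c c0; apply: zact_inj => u; apply: c0.
  - move=> a b; rewrite !xZE => ab; apply: zact_inj => u.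
    apply/eqP; rewrite -subr_eq0; apply/eqP/xreg.
    by rewrite scalerBr -!zactZ ab subrr.
  - by apply: contrapT => nb; apply: nex; exists f, y.
  - by exists c; rewrite xZE.
set w := f y in nfy.
have [r [wr _]] := residue_exists lp mine lift w.
have [v vr] : exists v, v * r = 1.
  apply: (local_unit lp); apply/negP => rm; apply: nfy.
  have := multipleD (act_s w r wr) (ss r rm); rewrite subrK => - [b wb].
  by exists b; rewrite xZE mulrC.
have fR : linear (f : M -> Zend M).
  move=> a u t; have := linearP f (homothety M a) (u : zend_module M) t.
  by move=> h; apply: (etrans h); rewrite [_ *: _]Zend_scalerAl mul1r.
have zw (z' : Zend M) : residue m z' 0 -> in_mul m (z' * w).
  move=> z'0; have <- : f (z' *: (y : zend_module M)) = z' * w by exact: linearZ_LR.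
  exact/(in_mul_image fR)/residue0_in_mul.
pose nu := w - homothety M r.
have nu0 : residue m nu 0 by apply: residueB_scalar.
have [k nuk] := residue0_nilpotent mine nu0.
have mulz (t u : Zend M) : in_mul m u -> in_mul m (t * u).
  by apply: in_mul_image => a u' u''; rewrite mulrDr Zend_scalerAr.
move=> z0; have := mulz z _ nuk; elim: k {nuk} => [|k IHk]; first by rewrite expr0 mulr1.
rewrite exprSr mulrA => h; apply: IHk.
have z'0 : residue m (z * nu ^+ k) 0 by rewrite mulrC; apply: residue0M.
rewrite -[z * _]scale1r -vr -scalerA; apply: in_mulZ.
have wnu : w - nu = homothety M r by rewrite opprB addrC subrK.
have := in_mulB (zw _ z'0) h; rewrite -mulrBr wnu.
by rewrite /homothety Zend_scalerAr mulr1.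
Qed.
End ReflexiveCase.

(** * The center as a fractional ideal, and the theorem *)

Section Denominator.
Variables (R : comNzRingType) (M : lmodType R).
Hypothesis M_tf : torsion_free M.
Variables (c : {linear M -> R^o}) (y0 : M).
Hypothesis cy0 : GRing.lreg (c y0 : R).

Lemma functional_faithful (a : R) : (forall y : M, a *: y = 0) -> a = 0.
Proof.
move=> a0; apply: cy0; rewrite mulr0 mulrC.
by change ((a : R) *: c y0 = 0); rewrite -linearZ_LR a0 linear0.
Qed.

(** The endomorphism y |-> c(y) u of rank one commutes with z. *)
Lemma functional_denominator (z : Zend M) (u : M) :
  (c y0 : R) *: zact z u = (c (zact z y0) : R) *: u.
Proof.
have Hl : linear (fun y => (c y : R) *: u).
  by move=> a v w; rewrite linearP scalerDl -scalerA.
pose H : {linear M -> M} := linear_of Hl.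
by have := zact_comm z H y0; rewrite /= linearZ_LR.
Qed.

(** The element c(y0) is a common denominator: multiplication by it embeds Z in R as
    an ideal. *)
Lemma Zend_finitely_generated : noetherian R -> finitely_generated (Zend M).
Proof.
move=> noeth; pose den (z : Zend M) : R := c (zact z y0).
have den_lin a z w : den (a *: z + w) = a * den z + den w.
  by rewrite /den zactD zactZ linearP.
have den_inj : injective den.
  move=> z w zw; apply: zact_inj => u; apply/eqP; rewrite -subr_eq0; apply/eqP.
  apply: (M_tf cy0); rewrite scalerBr !functional_denominator.
  by rewrite -/(den z) -/(den w) zw subrr.
have cl : submod_closed ((fun a => `[< exists z, a = den z >]) : pred R^o).
  split=> [|a _ _ /asboolP [z ->] /asboolP [w ->]]; apply/asboolP.
    by exists 0; rewrite /den zact0 linear0.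
  by exists (a *: z + w); rewrite den_lin.
pose I : ideal R := HB.pack ((fun a => `[< exists z, a = den z >]) : R^o -> bool)
  (GRing.isSubmodClosed.Build R R^o _ cl).
have [q [g gP]] := noeth I.
have gz i : exists z, val (g i) = den z by have /asboolP := valP (g i).
have [z zP] := choice gz; exists q, z => w.
have wI : (den w : R^o) \in (I : {pred R^o}) by apply/asboolP; exists w.
have [b /(congr1 val)] := gP (exist (fun y : R^o => y \in I) (den w) wI).
rewrite linear_sum /= => wE; exists b; apply: den_inj; rewrite wE.
have den_sum (s : seq 'I_q) : den (\sum_(i <- s) b i *: z i) = \sum_(i <- s) b i * den (z i).
  elim: s => [|i s IHs]; first by rewrite !big_nil /den zact0 linear0.
  by rewrite !big_cons den_lin IHs.
by rewrite den_sum; apply: eq_bigr => i _; rewrite -zP.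
Qed.
End Denominator.

(** With s in the socle of R / x R, reflexive_trace over R provides a value f(y) that
    does not kill s modulo x, that is, a unit. *)
Lemma reflexive_direct_summand (R : comNzRingType) (M : lmodType R) (m : idealr R) (x : R) :
    local_parameter m x ->
    (forall a : R, (forall y : M, a *: y = 0) -> a = 0) ->
    (forall z : Zend M, exists r, z = homothety M r) ->
  reflexive_module M -> direct_summand R^o M.
Proof.
move=> lp faithful scal refl.
have n1 : ~ multiple x (1 : R^o).
  move=> [w w1]; have := idealr1 m; rewrite w1.
  by rewrite [_ *: _]mulrC idealMr // (parameter_mem lp).
have [s [ns ss]] := socle_modulo_parameter lp n1.
have [f [y nfy]] : exists (f : {linear M -> R^o}) y, ~ exists b, s * f y = x * b.
  apply: contrapT => nex; apply: ns.
  apply: (reflexive_trace refl) => //.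
  - move=> g gC; have [z zg] := central_endomorphism gC.
    by have [r zr] := scal z; exists r => u; rewrite -zg zr /homothety zactZ zact1.
  - exact: parameter_reg lp.
  - by move=> f y; apply: contrapT => nb; apply: nex; exists f, y.
have [v vf] : exists v, v * f y = 1.
  apply: (local_unit lp); apply/negP => fm; apply: nfy.
  by have [b bE] := ss _ fm; exists b; rewrite mulrC.
exact: (split_functional (f := hom_scale v f) (y := y)).
Qed.

(** The isomorphism carries minimal generators and the lifting property of M to I;
    then M is cyclic, and a central endomorphism is determined by the multiple to
    which it sends the generator. *)
Lemma ideal_case_scalar (R : comNzRingType) (M : lmodType R) (m : idealr R) (x : R)
    (n : nat) (e : 'I_n.+1 -> M) (I : ideal R) :
    local_parameter m x -> minimal_generators m e ->
    (forall h : M -> M, linear_modulo (multiple x) h ->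
      exists H : {linear M -> M}, forall y, multiple x (H y - h y)) ->
    positive_grade I -> isomorphic M (ideal_module I) ->
    Ext_vanishes 1 (end_module (ideal_module I)) (End (ideal_module I))^o ->
  forall z : Zend M, exists r, z = homothety M r.
Proof.
move=> lp [ge me] lift Ipos [j [j' jK j'K]] ext.
have j'lin : linear j'.
  by move=> a u v; apply: (can_inj jK); rewrite linearP !j'K.
pose i : {linear ideal_module I -> M} := linear_of j'lin.
have j_mul u : multiple x u -> multiple x (j u).
  by move=> [w ->]; exists (j w); rewrite linearZ_LR.
have j_sum (b : 'I_n.+1 -> R) : j (\sum_l b l *: e l) = \sum_l b l *: j (e l).
  by rewrite linear_sum; apply: eq_bigr => l _; rewrite linearZ_LR.
have n0 : n = 0.
  apply: (@ideal_case_cyclic R m x I lp Ipos _ ext n (fun l => j (e l))).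
    move=> h hl; have [|H HP] := lift (fun u => i (h (j u))).
      move=> a u v; have [w hw] := hl a (j u) (j v); exists (i w).
      by rewrite (linearP j) -(linearZ_LR i x) -hw (linearB i) (linearP i).
    exists (j \o (H \o i)) => u; have := j_mul _ (HP (i u)).
    by rewrite linearB /= !j'K.
  split=> [u|b rel l].
    have [b be] := ge (i u); exists b.
    by rewrite -[LHS]j'K [j' u]be j_sum.
  by apply: me; apply: (can_inj jK); rewrite linear0 -[RHS]rel j_sum.
move=> z; case: n n0 e ge {me j_sum} => // _ e ge; have [b be] := ge (zact z (e ord0)).
exists (b ord0); apply: zact_inj => u; have [d ->] := ge u.
rewrite !big_ord1 in be *; rewrite linearZ_LR be /homothety zactZ zact1 !scalerA.
by rewrite mulrC.
Qed.

Theorem theorem1p3 (R : comNzRingType) (M : lmodType R)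
    (R_CM : cohen_macaulay_local R) (R_dim1 : krull_dim R 1)
    (M_fg : finitely_generated M) (M_tf : torsion_free M)
    (M_rank : exists2 r : nat, (0 < r)%N & has_rank M r)
    (M_ext : Ext_vanishes 1 M M)
    (M_alt :
       [\/ reflexive_module (zend_module M),
           Ext_vanishes 2 (zend_module M) (zend_module M)
         | exists I : ideal R,
             [/\ positive_grade I, isomorphic M (ideal_module I)
               & Ext_vanishes 1 (end_module (ideal_module I))
                   (End (ideal_module I))^o]]) :
  (exists f : {linear Zend M -> R^o},
     GRing.monoid_morphism f /\ bijective f)
  /\ (reflexive_module M -> direct_summand R^o M).
Proof.
have [noeth _] := R_CM.
have [m [x lp]] := CM_dim1_parameter R_CM R_dim1.
have [r r0 Mr] := M_rank; have [c [y0 cy0]] := rank_functional Mr r0 M_fg.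
have faithful := functional_faithful cy0.
have ext1 : extends_from_syzygy M M := Ext_vanishes_extends (n := 0) M_ext.
have lift (h : M -> M) : linear_modulo (multiple x) h ->
    exists H : {linear M -> M}, forall y, multiple x (H y - h y).
  apply: lift_linear_modulo => // [a|u]; first exact: mulrC.
  exact/M_tf/(parameter_reg lp).
have fgZ := Zend_finitely_generated M_tf cy0 noeth.
have [[|n] [e mine]] := minimal_generators_exist lp M_fg.
  have /eqP : (1 : R) = 0; last by rewrite oner_eq0.
  by apply: faithful => y; have [b ->] := mine.1 y; rewrite big_ord0 scaler0.
have scal (z : Zend M) : exists r, z = homothety M r.
  case: M_alt => [refl|ext2|[I [Ipos MI extI]]].
  - apply: (Zend_scalar_of_residue0 lp mine lift fgZ) => w.
    exact: (reflexive_residue0_in_mul lp M_tf mine lift).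
  - apply: (Zend_scalar_of_residue0 lp mine lift fgZ) => w.
    apply: (residue0_in_mul_Zend lp M_tf faithful mine ext1 _ cy0 _ fgZ).
      exact: (Ext_vanishes_extends (n := 1)).
    exact: functional_denominator.
  - exact: (ideal_case_scalar lp mine lift Ipos MI extI).
split; first exact: Zend_isomorphism.
exact: (reflexive_direct_summand lp).
Qed.
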